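(* Let $\{\mathcal{G}(t)\}_{t\ge 0}$ be a time-indexed sequence of strongly connected and weight-balanced digraphs on a common set of $n\ge 2$ nodes, with adjacency matrices $\mathsf{A}(t)$ and Laplacians $\mathsf{L}(t)$, and with uniformly bounded edge weights (i.e., there exists $a\in(0,\infty)$ such that $\mathsf{A}_{ij}(t)<a$ for all $(i,j)$ and $t\ge 0$). Let $A_i\in\mathbb{R}^{m\times m}$, $b_i\in\mathbb{R}^m$ for $i\in\{1,\dots,n\}$, put $A=\sum_{i=1}^n A_i$, $b=\sum_{i=1}^n b_i$, and assume that the equation $Ax=b$ has at least one solution $x\in\mathbb{R}^m$. Assume $\mathrm{null}(A)\subseteq\mathrm{null}(A_i)$ for all $i\in\{1,\dots,n\}$. Let $\mathbf{L}(t)=\mathsf{L}(t)\otimes I_m$, $\mathbf{A}=\mathrm{blkdiag}(A_1,\dots,A_n)$, $\mathbf{b}=[b_1;\dots;b_n]$ and $U=\mathbf{1}_n\otimes I_m$. Let $\alpha,\beta>0$ and define $$\bar\gamma(t)=\max\left\{\frac{2}{\lambda_2(\mathsf{L}(t)+\mathsf{L}(t)^\top)}\,\lambda_{\max}\!\left(\frac{\mathbf{Q}_{12}(t)^\top\mathbf{Q}_{12}(t)}{\lambda_2(\mathbf{Q}_{11}(t))}-n\beta\mathbf{A}\mathbf{A}^\top\right),\,0\right\},$$ where $$\mathbf{Q}_{11}(t)=\tfrac12\alpha(\mathbf{L}(t)+\mathbf{L}(t)^\top)+\beta\mathbf{A}^\top UU^\top\mathbf{A},\qquad \mathbf{Q}_{12}(t)=\tfrac12\left(n\beta\mathbf{A}^\top+\alpha\mathbf{L}(t)^\top\mathbf{A}^\top+\beta\mathbf{A}^\top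 UU^\top\mathbf{A}\mathbf{A}^\top\right).$$ Then, for all $\gamma\in(\hat\gamma,\infty)$, where $\hat\gamma=\sup_{t\ge0}\bar\gamma(t)$, any trajectory $(\mathbf{x}(t),\mathbf{y}(t))\in\mathbb{R}^{mn}\times\mathbb{R}^{mn}$, $t\ge0$, of $$\dot{\mathbf{x}}=-\alpha\mathbf{L}(t)\mathbf{x}-n\beta\mathbf{A}^\top\mathbf{y},\qquad \dot{\mathbf{y}}=-\alpha\mathbf{A}\mathbf{L}(t)\mathbf{x}-n\beta\mathbf{A}\mathbf{A}^\top\mathbf{y}-\gamma\mathbf{L}(t)\mathbf{y}$$ with initial conditions satisfying $U^\top\mathbf{y}(0)=U^\top(\mathbf{A}\mathbf{x}(0)-\mathbf{b})$ converges exponentially to $(\mathbf{x}^*,\mathbf{0})$, where $\mathbf{x}^*=\mathbf{1}_n\otimes x^*$ and $x^*\in\mathbb{R}^m$ satisfies $Ax^*=b$.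
   Context: A weighted digraph $\mathcal{G}=(\mathcal{V},\mathcal{E},\mathsf{A})$ with $|\mathcal{V}|=n$ has adjacency matrix $\mathsf{A}\in\mathbb{R}^{n\times n}$ with $\mathsf{A}_{ij}>0$ if there is an edge from node $i$ to node $j$, and $\mathsf{A}_{ij}=0$ otherwise. The weighted out- and in-degrees of node $i$ are $\sum_{j}\mathsf{A}_{ij}$ and $\sum_{j}\mathsf{A}_{ji}$; $\mathsf{D}^{\mathrm{out}}$ and $\mathsf{D}^{\mathrm{in}}$ are the corresponding diagonal matrices. The graph is weight-balanced if $\mathsf{D}^{\mathrm{out}}=\mathsf{D}^{\mathrm{in}}$, and strongly connected if there is a directed path between any two distinct nodes. The Laplacian is $\mathsf{L}=\mathsf{D}^{\mathrm{in}}-\mathsf{A}$. $\mathbf{1}_n\in\mathbb{R}^n$ is the all-ones vector, $I_m$ the $m\times m$ identity, $\otimes$ the Kronecker product, $\mathrm{blkdiag}(A_1,\dots,A_n)\in\mathbb{R}^{mn\times mn}$ the block-diagonal matrix with the given diagonal blocks, and $[b_1;\dots;b_n]\in\mathbb{R}^{mn}$ the stacked vector. $\mathrm{null}(\cdot)$ is the null space, $\lambda_{\max}(\cdot)$ the maximum eigenvalue of a symmetric matrix, and $\lambda_2(\cdot)$ the minimum non-zero eigenvalue of a positive semidefinite matrix (regardless of the multiplicity of the eigenvalue $0$). Time $t$ is continuous, $t\in[0,\infty)$. A trajectory $z(t)$ converges exponentially to $z^*$ if there are constants $C,\mu>0$ with $\|z(t)-z^*\|\le Ce^{-\mu t}$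 for all $t\ge 0$.
   Formalization: In the degenerate case A = 0 (all A_i = 0) the formal statement also assumes that λ_2(L(t)+L(t)^T) is bounded below by a positive constant for all t ≥ 0; without this the claim fails, e.g. for n = 2, m = 1 and edge weights e^{-t}. Nothing is added when A ≠ 0. *)

(* Defs.v *)
From mathcomp Require Import all_boot all_order all_algebra.
From mathcomp Require Import all_classical all_reals all_analysis.
From mathcomp Require Export mxtens.

Set Implicit Arguments.
Unset Strict Implicit.
Unset Printing Implicit Defensive.

Import Order.TTheory GRing.Theory Num.Theory.
Import numFieldNormedType.Exports.

Local Open Scope classical_set_scope.
Local Open Scope ring_scope.

Record wdigraph (R : realType) (n : nat) := WDigraph {
  edge : rel 'I_n;
  adj : 'M[R]_n;
  adj_gt0 : forall i j, edge i j -> 0 < adj i j;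
  adj_eq0 : forall i j, ~~ edge i j -> adj i j = 0 }.

Section Graphs.
Context {R : realType} {n : nat}.
Implicit Type G : wdigraph R n.

Definition deg_out G : 'M[R]_n := diag_mx (\row_i \sum_j adj G i j).
Definition deg_in G : 'M[R]_n := diag_mx (\row_i \sum_j adj G j i).
Definition weight_balanced G : Prop := deg_out G = deg_in G.
Definition strongly_connected G : Prop :=
  forall i j : 'I_n, i != j -> connect (edge G) i j.
Definition laplacian G : 'M[R]_n := deg_in G - adj G.
End Graphs.

Section Spectrum.
Context {R : realType} {k : nat}.
Implicit Type M : 'M[R]_k.

(* A matrix has finitely many eigenvalues, so whenever the set below is
   nonempty this [sup] (resp. [inf]) is a maximum (resp. a minimum). *)
Definition lambda_max M : R := sup [set c : R | eigenvalue M c].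
Definition lambda2 M : R := inf [set c : R | eigenvalue M c /\ c != 0].
End Spectrum.

(* R^(mn) is 'cV_(n * m), with entry p of block i at [mxtens_index (i, p)];
   this is the indexing of the Kronecker product [*t] of mxtens. *)
Section Blocks.
Context {R : realType} {n m : nat}.

Definition blkdiag (As : 'I_n -> 'M[R]_m) : 'M[R]_(n * m) :=
  \matrix_(k, l)
    (if (mxtens_unindex k).1 == (mxtens_unindex l).1
     then As (mxtens_unindex k).1 (mxtens_unindex k).2 (mxtens_unindex l).2
     else 0).

Definition stack (bs : 'I_n -> 'cV[R]_m) : 'cV[R]_(n * m) :=
  \col_k bs (mxtens_unindex k).1 (mxtens_unindex k).2 0.
End Blocks.

(* 1_n (x) I_m; the number of columns reads 1 * m instead of m. *)
Definition ones_kron (R : realType) (n m : nat) : 'M[R]_(n * m, 1 * m) :=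
  (const_mx 1 : 'cV[R]_n) *t (1%:M : 'M[R]_m).

(* 1_n (x) v; here the number of columns 1 * 1 is convertible to 1. *)
Definition replicate (R : realType) (n m : nat) (v : 'cV[R]_m) :
  'cV[R]_(n * m) := (const_mx 1 : 'cV[R]_n) *t v.

Section Gains.
Context {R : realType} {n m : nat}.
Variables (As : 'I_n -> 'M[R]_m) (alpha beta : R).
Implicit Type G : wdigraph R n.

Let bA := blkdiag As.
Let U := ones_kron R n m.

Definition block_laplacian G : 'M[R]_(n * m) := laplacian G *t (1%:M : 'M[R]_m).

Definition Q11 G : 'M[R]_(n * m) :=
  (alpha / 2) *: (block_laplacian G + (block_laplacian G)^T)
  + beta *: (bA^T *m U *m U^T *m bA).

Definition Q12 G : 'M[R]_(n * m) :=
  2^-1 *: ((n%:R * beta) *: bA^T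
           + alpha *: ((block_laplacian G)^T *m bA^T)
           + beta *: (bA^T *m U *m U^T *m bA *m bA^T)).

Definition gamma_bar G : R :=
  Num.max (2 / lambda2 (laplacian G + (laplacian G)^T)
           * lambda_max ((lambda2 (Q11 G))^-1 *: ((Q12 G)^T *m Q12 G)
                         - (n%:R * beta) *: (bA *m bA^T)))
          0.

(* The supremum may be +oo, in which case no real gamma exceeds it. *)
Definition gamma_hat (G : R -> wdigraph R n) : \bar R :=
  ereal_sup [set (gamma_bar (G t))%:E | t in [set t : R | 0 <= t]].
End Gains.

Section Trajectories.
Context {R : realType}.

(* Absolute continuity on [0, T] for every T. *)
Definition locally_abs_continuous (k : nat) (f : R -> 'cV[R]_k) : Prop :=
  forall T : R, 0 <= T -> forall e : R, 0 < e -> exists2 d : R, 0 < d &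
    forall (N : nat) (u v : 'I_N -> R),
      (forall i, 0 <= u i /\ u i <= v i /\ v i <= T) ->
      (forall i j : 'I_N, (i < j)%N -> v i <= u j) ->
      \sum_i (v i - u i) < d ->
      \sum_i `|f (v i) - f (u i)| < e.

(* Solutions in the sense of Caratheodory: the graph may switch arbitrarily
   in time, so differentiability everywhere would be too much to ask.  As the
   weights are bounded, every classical solution is one in this sense. *)
Definition is_trajectory (n m : nat) (As : 'I_n -> 'M[R]_m)
    (alpha beta gamma : R) (G : R -> wdigraph R n)
    (x y : R -> 'cV[R]_(n * m)) : Prop :=
  let bA := blkdiag As in
  let bL t := block_laplacian (m := m) (G t) in
  [/\ locally_abs_continuous x, locally_abs_continuous y &
      {ae lebesgue_measure, forall t : R, 0 <= t ->
        is_derive t 1 x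
          (- (alpha *: (bL t *m x t)) - (n%:R * beta) *: (bA^T *m y t)) /\
        is_derive t 1 y
          (- (alpha *: (bA *m bL t *m x t))
           - (n%:R * beta) *: (bA *m bA^T *m y t)
           - gamma *: (bL t *m y t))}].

Definition norm2 (k : nat) (v : 'cV[R]_k) : R :=
  Num.sqrt (\sum_i v i 0 ^+ 2).

Definition converges_exponentially (k : nat) (z : R -> 'cV[R]_k)
    (zs : 'cV[R]_k) : Prop :=
  exists C mu : R, [/\ 0 < C, 0 < mu &
    forall t : R, 0 <= t -> norm2 (z t - zs) <= C * expR (- mu * t)].
End Trajectories.

(* Main.v *)
Require Import Defs.
From mathcomp Require Import all_boot all_order all_algebra.
From mathcomp Require Import all_classical all_reals all_analysis.
From mathcomp Require Import ring lra.

Set Implicit Arguments.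
Unset Strict Implicit.
Unset Printing Implicit Defensive.

Import Order.TTheory GRing.Theory Num.Theory.
Import numFieldNormedType.Exports.

Local Open Scope ring_scope.

(** Write [S] for the block sum [z |-> sum_i z_i], so that [S^T] replicates a
    vector [n] times, and let [e = x - S^T xs].  Balanced Laplacians have zero
    row and column sums, hence [S y - S bA x] is conserved
    ([blocksum_conserved]), and the initial condition makes it
    [S y = S bA e] at all times.  Splitting [y = yp + S^T (S y) / n] and
    substituting, the derivative of [(|e|^2 + |yp|^2) / 2] is minus the quadratic
    form [dissipation]
    [e Q11 e + 2 e Q12 yp + yp (n beta bA bA^T + gamma L) yp]
    ([dissipation_identity]); this is where the matrices [Q11] and [Q12] come
    from.

    The form cannot see the component of [e] in the null space of [Q11], which
    consists of the replicated null vectors of [A].  Since every [A_i] kills the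
    null vectors of [A], that component is conserved ([perp_conserved]), and
    choosing the solution [xs] of [A xs = b] suitably makes it zero.  On the
    remaining vectors Young's inequality, with the bound [gamma_bar <= g < gamma],
    shows that the form is positive definite ([dissipation_ge]).

    Exponential convergence needs a coercivity constant that does not depend on
    time ([coercive_uniform]).  A Fiedler vector of the graph gives
    [lambda2 Q11 <= alpha / 2 * lambda2 (L + L^T)] ([lambda2_Q11]).  On the other
    hand the bilinear form of [Q12] takes on certain replicated vectors a value
    that does not involve the graph and is nonzero when [A <> 0] ([Q12_rep]), while
    finiteness of the gain and boundedness of the weights bound [Q12^T Q12] by a
    multiple of [lambda2 Q11] ([gain_bound]).  Therefore [lambda2 Q11], and with it
    the algebraic connectivity, stays away from zero.  When [A = 0] all the [A_i]
    vanish, and the assumed lower bound on the connectivity takes over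
    ([coercive_degenerate]).

    Solutions are only absolutely continuous, so monotonicity of the Lyapunov
    function rests on [abs_cont_nonincreasing]: an absolutely continuous function
    whose derivative is nonpositive almost everywhere is nonincreasing.  The
    eigenvalue inequalities are obtained by minimising Rayleigh quotients
    ([rayleigh_min]). *)

(** * Euclidean inner product *)

Section Dot.
Context {R : realType}.

Definition dot (k : nat) (u v : 'cV[R]_k) : R := \sum_i u i 0 * v i 0.

Lemma dotC k (u v : 'cV[R]_k) : dot u v = dot v u.
Proof. by apply: eq_bigr => i _; rewrite mulrC. Qed.

Lemma dotDl k (u v w : 'cV[R]_k) : dot (u + v) w = dot u w + dot v w.
Proof. by rewrite -big_split; apply: eq_bigr => i _; rewrite mxE mulrDl. Qed.

Lemma dotZl k a (u v : 'cV[R]_k) : dot (a *: u) v = a * dot u v.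
Proof. by rewrite mulr_sumr; apply: eq_bigr => i _; rewrite mxE mulrA. Qed.

Lemma dotNl k (u v : 'cV[R]_k) : dot (- u) v = - dot u v.
Proof. by rewrite -scaleN1r dotZl mulN1r. Qed.

Lemma dotBl k (u v w : 'cV[R]_k) : dot (u - v) w = dot u w - dot v w.
Proof. by rewrite dotDl dotNl. Qed.

Lemma dot0l k (v : 'cV[R]_k) : dot 0 v = 0.
Proof. by rewrite -(scale0r v) dotZl mul0r. Qed.

Lemma dotDr k (u v w : 'cV[R]_k) : dot w (u + v) = dot w u + dot w v.
Proof. by rewrite !(dotC w) dotDl. Qed.

Lemma dotZr k a (u v : 'cV[R]_k) : dot u (a *: v) = a * dot u v.
Proof. by rewrite !(dotC u) dotZl. Qed.

Lemma dotNr k (u v : 'cV[R]_k) : dot v (- u) = - dot v u.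
Proof. by rewrite !(dotC v) dotNl. Qed.

Lemma dotBr k (u v w : 'cV[R]_k) : dot w (u - v) = dot w u - dot w v.
Proof. by rewrite dotDr dotNr. Qed.

Lemma dot0r k (v : 'cV[R]_k) : dot v 0 = 0.
Proof. by rewrite dotC dot0l. Qed.

Lemma dot_ge0 k (u : 'cV[R]_k) : 0 <= dot u u.
Proof. by apply: sumr_ge0 => i _; rewrite -expr2 sqr_ge0. Qed.

Lemma dot_eq0 k (u : 'cV[R]_k) : dot u u = 0 -> u = 0.
Proof.
move/eqP; rewrite psumr_eq0 => [|i _]; last by rewrite -expr2 sqr_ge0.
move/allP => h; apply/colP => i; rewrite mxE.
by have := h i (mem_index_enum _); rewrite /= -expr2 sqrf_eq0 => /eqP.
Qed.

Lemma dot_gt0 k (u : 'cV[R]_k) : u != 0 -> 0 < dot u u.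
Proof.
move=> u0; rewrite lt_neqAle dot_ge0 andbT eq_sym.
by apply: contra u0 => /eqP/dot_eq0 ->.
Qed.

Lemma dot_mulmx p k (M : 'M[R]_(p, k)) u v :
  dot (M *m u) v = dot u (M^T *m v).
Proof.
rewrite /dot; under eq_bigr do rewrite mxE mulr_suml.
rewrite exchange_big /=; apply: eq_bigr => j _.
by rewrite mxE mulr_sumr; apply: eq_bigr => i _; rewrite mxE; ring.
Qed.

Lemma dot_mulmxr p k (M : 'M[R]_(p, k)) u v :
  dot v (M *m u) = dot (M^T *m v) u.
Proof. by rewrite dotC dot_mulmx dotC. Qed.

Lemma dot_delta k (u : 'cV[R]_k) i : dot (delta_mx i 0) u = u i 0.
Proof.
rewrite /dot (bigD1 i) //= big1 => [|j ji]; first by rewrite mxE !eqxx mul1r addr0.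
by rewrite mxE (negPf ji) mul0r.
Qed.

Lemma dot_CauchySchwarz k (u v : 'cV[R]_k) : dot u v ^+ 2 <= dot u u * dot v v.
Proof.
have [->|v0] := eqVneq v 0; first by rewrite !dot0r mulr0 expr0n.
have vv := dot_gt0 v0.
have := dot_ge0 (dot v v *: u - dot u v *: v).
rewrite !(dotBl, dotBr, dotZl, dotZr) (dotC v u) => h.
rewrite -subr_ge0 -(pmulr_rge0 _ vv); apply: le_trans h _.
by rewrite le_eqVlt; apply/orP; left; apply/eqP; ring.
Qed.

Lemma mulmx_bounded p k (M : 'M[R]_(p, k)) :
  exists2 K : R, 0 < K & forall u, dot (M *m u) (M *m u) <= K * dot u u.
Proof.
exists (\sum_i dot (row i M)^T (row i M)^T + 1) => [|u].
  by rewrite ltr_wpDl // sumr_ge0 // => i _; exact: dot_ge0.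
rewrite mulrDl mul1r ler_wpDr ?dot_ge0 // mulr_suml; apply: ler_sum => i _.
rewrite -expr2; have -> : (M *m u) i 0 = dot (row i M)^T u.
  by rewrite mxE; apply: eq_bigr => j _; rewrite !mxE.
exact: dot_CauchySchwarz.
Qed.

Lemma dot_coord_le k (u : 'cV[R]_k) i : u i 0 ^+ 2 <= dot u u.
Proof.
rewrite /dot (bigD1 i) //= -expr2 lerDl sumr_ge0 // => j _.
by rewrite -expr2 sqr_ge0.
Qed.

End Dot.

(** * Extremal eigenvalues of symmetric matrices *)

Section Spectral.
Context {R : realType}.
Local Open Scope classical_set_scope.

Lemma continuous_quad k (M : 'M[R]_k) :
  continuous (fun r : 'rV[R]_k => dot r^T (M *m r^T)).
Proof.
have -> : (fun r : 'rV[R]_k => dot r^T (M *m r^T))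
  = (fun r => \sum_i \sum_j r 0 i * (M i j * r 0 j)).
  apply/funext => r; apply: eq_bigr => i _; rewrite !mxE mulr_sumr.
  by apply: eq_bigr => j _; rewrite !mxE.
have c i : continuous (fun r : 'rV[R]_k => r 0 i) by exact: coord_continuous.
have big (F : 'I_k -> 'rV[R]_k -> R) : (forall i, continuous (F i)) ->
    continuous (fun r => \sum_i F i r).
  move=> cF; apply: continuous_big; [exact: add_continuous|by move=> i _; exact: cF].
apply: (big) => i; apply: (big) => j r.
apply: (continuousM (s := fun r : 'rV[R]_k => r 0 i)); first exact: c.
apply: (continuousM (s := fun=> M i j)); [exact: cst_continuous|exact: c].
Qed.

(** Both constraints are level sets of quadratic forms, as [K r = 0] amounts to
    [r (K^T K) r = 0]. *)
Lemma compact_sphere k p (K : 'M[R]_(p, k)) :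
  compact [set r : 'rV[R]_k | dot r^T r^T = 1 /\ K *m r^T = 0].
Proof.
apply: bounded_closed_compact.
  exists 1; split; first exact: num_real.
  move=> x x1 r /= [r1 _]; rewrite [leLHS]/Num.Def.normr /= mx_normrE.
  apply: bigmax_le => [|[i j] _ /=]; first by rewrite ltW // (lt_trans _ x1).
  rewrite ord1 (le_trans _ (ltW x1)) // -(@ler_pXn2r _ 2) ?nnegrE // expr1n.
  rewrite real_normK ?num_real // -r1.
  by have := dot_coord_le r^T j; rewrite mxE.
have -> : [set r : 'rV[R]_k | dot r^T r^T = 1 /\ K *m r^T = 0]
  = (fun r : 'rV[R]_k => dot r^T (1%:M *m r^T)) @^-1` [set 1]
    `&` (fun r : 'rV[R]_k => dot r^T ((K^T *m K) *m r^T)) @^-1` [set 0].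
  apply/seteqP; split => r /=; rewrite mul1mx -mulmxA dot_mulmxr trmxK.
    by move=> [-> ->]; rewrite dot0l.
  by move=> [-> /dot_eq0 ->].
have cl (N : 'M[R]_k) (a : R) :
    closed ((fun r : 'rV[R]_k => dot r^T (N *m r^T)) @^-1` [set a]).
  apply: (continuous_closedP _).1; last exact: closed_eq.
  exact: continuous_quad.
by apply: closedI; exact: cl.
Qed.

(** The Rayleigh quotient attains its minimum on the unit sphere of the
    invariant subspace [ker K].  The form of [M - c] is then nonnegative on
    [ker K] and vanishes at the minimiser [e], so its gradient [M e - c e],
    which lies in [ker K], is zero. *)
Lemma rayleigh_min k p (M : 'M[R]_k) (K : 'M[R]_(p, k)) :
  M^T = M -> (forall e : 'cV[R]_k, K *m e = 0 -> K *m (M *m e) = 0) ->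
  (exists2 e : 'cV[R]_k, e != 0 & K *m e = 0) ->
  exists c : R, exists e : 'cV[R]_k,
    [/\ e != 0, K *m e = 0, M *m e = c *: e &
        forall h : 'cV[R]_k, K *m h = 0 -> c * dot h h <= dot h (M *m h)].
Proof.
move=> symM invM [e0 e0N0 Ke0].
have unit_of (h : 'cV[R]_k) : h != 0 ->
    dot ((Num.sqrt (dot h h))^-1 *: h) ((Num.sqrt (dot h h))^-1 *: h) = 1.
  move=> /dot_gt0 h0; rewrite dotZl dotZr mulrA -invfM -expr2 sqr_sqrtr ?ltW //.
  by rewrite mulVf // gt_eqF.
set A := [set r : 'rV[R]_k | dot r^T r^T = 1 /\ K *m r^T = 0].
have A0 : A !=set0.
  exists ((Num.sqrt (dot e0 e0))^-1 *: e0)^T; split; rewrite /= trmxK ?unit_of //.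
  by rewrite -scalemxAr Ke0 scaler0.
have cA : compact A by exact: compact_sphere.
have [] := @EVT_min_rV _ _ (fun r : 'rV[R]_k => dot r^T (M *m r^T)) A A0 cA.
  by apply: continuous_subspaceT; exact: continuous_quad.
move=> r /set_mem [/= r1 Kr] minr.
set e := r^T in r1 Kr minr.
set c := dot e (M *m e) in minr.
have e_neq0 : e != 0.
  by apply/eqP => e0'; move: r1; rewrite e0' dot0l => /eqP; rewrite eq_sym oner_eq0.
have min h : K *m h = 0 -> c * dot h h <= dot h (M *m h).
  move=> Kh; have [->|h0] := eqVneq h 0; first by rewrite !dot0l mulr0.
  set s := (Num.sqrt (dot h h))^-1.
  have := minr (s *: h)^T; rewrite inE /A /= trmxK.
  have sP : dot (s *: h) (s *: h) = 1 /\ K *m (s *: h) = 0.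
    by split; [exact: unit_of | rewrite -scalemxAr Kh scaler0].
  move=> /(_ sP) hc.
  have hh := dot_gt0 h0.
  have s2 : s ^+ 2 * dot h h = 1 by rewrite -(unit_of _ h0) dotZl dotZr mulrA expr2.
  have s2_gt0 : 0 < s ^+ 2 by rewrite exprn_gt0 // invr_gt0 sqrtr_gt0.
  rewrite -scalemxAr dotZl dotZr mulrA -expr2 in hc.
  rewrite -(ler_pM2l s2_gt0); apply: le_trans hc.
  by rewrite mulrCA s2 mulr1.
exists c, e; split => //.
have [g gE] : exists g, g = M *m e - c *: e by eexists.
have Kg : K *m g = 0 by rewrite gE mulmxBr invM // -scalemxAr Kr scaler0 subrr.
suff : g = 0 by rewrite gE => /eqP; rewrite subr_eq0 => /eqP.
apply: dot_eq0; apply/eqP; rewrite eq_le dot_ge0 andbT leNgt; apply/negP => gg.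
set b := dot g (M *m g) - c * dot g g.
have b0 : 0 <= b by rewrite subr_ge0 min.
(* The minimiser of [2 t |g|^2 + t^2 b] would be [- |g|^2 / b]; adding 1 to the
   denominator allows [b = 0] and still gives a negative value. *)
set t := - (dot g g) / (b + 1).
have Kt : K *m (e + t *: g) = 0 by rewrite mulmxDr -scalemxAr Kr Kg scaler0 addr0.
have eMg : dot e (M *m g) = dot g (M *m e) by rewrite dot_mulmxr symM dotC.
have gMe : dot g (M *m e) = dot g g + c * dot g e.
  by rewrite -dotZr -dotDr {3}gE subrK.
have := min _ Kt.
rewrite mulmxDr -scalemxAr !(dotDl, dotDr, dotZl, dotZr) eMg gMe -/c r1 (dotC e g).
rewrite -subr_ge0.
have -> : c + t * (dot g g + c * dot g e)
    + (t * (dot g g + c * dot g e) + t * (t * dot g (M *m g)))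
    - c * (1 + t * dot g e + (t * dot g e + t * (t * dot g g)))
    = 2 * t * dot g g + t ^+ 2 * b by rewrite /b; ring.
have -> : 2 * t * dot g g + t ^+ 2 * b
    = - ((dot g g / (b + 1)) ^+ 2 * (b + 2)).
  by rewrite /t; field; rewrite gt_eqF // ltr_wpDl.
rewrite oppr_ge0 leNgt mulr_gt0 // ?exprn_gt0 ?divr_gt0 //; lra.
Qed.

Lemma eigenvalueP_col k (M : 'M[R]_k) c : M^T = M ->
  eigenvalue M c <-> exists2 e : 'cV[R]_k, e != 0 & M *m e = c *: e.
Proof.
move=> symM; split => [/eigenvalueP[v vM v0]|[e e0 Me]].
  by exists v^T; rewrite ?trmx_eq0 // -{1}symM -trmx_mul vM linearZ.
apply/eigenvalueP; exists e^T; last by rewrite trmx_eq0.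
by rewrite -{1}symM -trmx_mul Me linearZ.
Qed.

(** Apply [rayleigh_min] to [- M] on the whole space: the minimum it attains is
    minus the largest eigenvalue. *)
Lemma lambda_maxP k (M : 'M[R]_k) : M^T = M ->
  forall h : 'cV[R]_k, dot h (M *m h) <= lambda_max M * dot h h.
Proof.
move=> symM h.
have [->|h0] := eqVneq h 0; first by rewrite !dot0l mulr0.
have [|||c [e [e0 _ Me cmin]]] := @rayleigh_min k 1 (- M) 0.
- by rewrite linearN /= symM.
- by move=> e _; rewrite mul0mx.
- by exists h; rewrite ?mul0mx.
have Mec : M *m e = (- c) *: e by rewrite scaleNr -Me mulNmx opprK.
have bound (v : 'cV[R]_k) : dot v (M *m v) <= - c * dot v v.
  have := cmin v; rewrite mul0mx mulNmx dotNr => /(_ erefl); lra.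
suff -> : lambda_max M = - c by exact: bound.
rewrite /lambda_max.
have eigc : [set a : R | eigenvalue M a] (- c).
  by apply/(eigenvalueP_col _ symM); exists e.
have ub : ubound [set a : R | eigenvalue M a] (- c).
  move=> a /= /(eigenvalueP_col _ symM)[v v0 Mv].
  by have := bound v; rewrite Mv dotZr ler_pM2r // dot_gt0.
apply/eqP; rewrite eq_le ge_sup //=; last by exists (- c).
by apply: ub_le_sup => //; exists (- c).
Qed.

(** The orthogonal complement of the null space is invariant under [M], so the
    Rayleigh quotient has a minimum there, which is an eigenvalue.  It is nonzero
    because an eigenvector for 0 would be orthogonal to itself, and it is the
    least nonzero one because eigenvectors for nonzero eigenvalues lie in the
    range of [M], hence in the complement. *)
Lemma lambda2P k (M : 'M[R]_k) : M^T = M ->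
  (forall e : 'cV[R]_k, 0 <= dot e (M *m e)) -> M != 0 ->
  [/\ 0 < lambda2 M,
      exists2 e : 'cV[R]_k, e != 0 & M *m e = lambda2 M *: e &
      forall h : 'cV[R]_k, (forall v, M *m v = 0 -> dot v h = 0) ->
        lambda2 M * dot h h <= dot h (M *m h)].
Proof.
move=> symM psdM M0.
pose K := kermx M.
have KM : K *m M = 0 by exact: mulmx_ker.
have KP (h : 'cV[R]_k) : (forall v, M *m v = 0 -> dot v h = 0) -> K *m h = 0.
  move=> hv; apply/colP => i; rewrite [RHS]mxE -dot_delta dot_mulmxr; apply: hv.
  by rewrite mulmxA -{1}symM -trmx_mul KM trmx0 mul0mx.
have Kperp (h v : 'cV[R]_k) : K *m h = 0 -> M *m v = 0 -> dot v h = 0.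
  move=> Kh Mv; have /submxP[D vD] : (v^T <= K)%MS.
    by apply/sub_kermxP; rewrite -{1}symM -trmx_mul Mv trmx0.
  by rewrite -[v]trmxK vD trmx_mul dot_mulmx trmxK Kh dot0r.
have [||c [e [e0 Ke Me cmin]]] := @rayleigh_min k k M K symM.
- by move=> e _; rewrite mulmxA KM mul0mx.
- have [i [j Mij]] : exists i, exists j, M i j != 0.
    apply: contrapT => h; case/eqP: M0; apply/matrixP => i j; rewrite mxE.
    by apply: contrapT => /eqP Mij; apply: h; exists i, j.
  exists (M *m delta_mx j 0); last by rewrite mulmxA KM mul0mx.
  by apply: contraNneq Mij => /colP/(_ i); rewrite -colE !mxE => ->.
have ee := dot_gt0 e0.
have c0 : 0 < c.
  have : 0 <= c by rewrite -(pmulr_lge0 _ ee) -dotZr -Me.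
  rewrite le_eqVlt => /orP[/eqP c0|//].
  have : dot e e = 0 by apply: Kperp => //; rewrite Me -c0 scale0r.
  by move/eqP; rewrite gt_eqF.
have eigc : [set a : R | eigenvalue M a /\ a != 0] c.
  by split; [apply/(eigenvalueP_col _ symM); exists e | rewrite gt_eqF].
have lb : lbound [set a : R | eigenvalue M a /\ a != 0] c.
  move=> a /= [/(eigenvalueP_col _ symM)[v v0 Mv] a0].
  have Kv : K *m v = 0.
    have -> : v = a^-1 *: (M *m v) by rewrite Mv scalerA mulVf // scale1r.
    by rewrite -scalemxAr mulmxA KM mul0mx scaler0.
  by have := cmin v Kv; rewrite Mv dotZr ler_pM2r // dot_gt0.
have -> : lambda2 M = c.
  apply/eqP; rewrite eq_le; apply/andP; split.
    by apply: ge_inf => //; exists c.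
  by apply: lb_le_inf => //; exists c.
split=> [//||h hv]; first by exists e.
by apply: cmin; exact: KP.
Qed.

End Spectral.

(** * Absolutely continuous functions with nonpositive derivative *)

Section AbsCont.
Context {R : realType}.
Local Open Scope classical_set_scope.

(** The supremum of the points of [[a, b]] that satisfy [P] satisfies [P] by the
    left half of the local condition, and would not be maximal by the right half
    unless it were [b]. *)
Lemma real_induction (P : R -> Prop) (a b : R) : a <= b -> P a ->
  (forall t, a <= t <= b -> exists2 r : R, 0 < r &
     (forall s, a <= s -> t - r < s <= t -> P s -> P t) /\
     (forall s, s <= b -> t <= s < t + r -> P t -> P s)) ->
  P b.
Proof.
move=> ab Pa loc.
set S := [set s | a <= s <= b /\ P s].
have Sa : S a by split; rewrite ?lexx.
have ubS : ubound S b by move=> s [/andP[]].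
have supS : has_sup S by split; [exists a | exists b].
have aS : a <= sup S by apply: ub_le_sup => //; exists b.
have Sb : sup S <= b by apply: ge_sup => //; exists a.
have [|r r0 [left right]] := loc (sup S); first by rewrite aS.
have [s [/andP[as_ sb] Ps] ss] := sup_adherent r0 supS.
have PS : P (sup S).
  apply: (left s) => //; rewrite ss /=; apply: ub_le_sup; first by exists b.
  by split; rewrite ?as_.
have [<-//|Sb'] := eqVneq (sup S) b.
have ltSb : sup S < b by rewrite lt_neqAle Sb'.
pose s' := Num.min b (sup S + r / 2).
have Ss' : sup S < s' by rewrite lt_min ltSb ltrDl divr_gt0.
have s'b : s' <= b by rewrite ge_min lexx.
have : S s'.
  split; first by rewrite s'b (le_trans aS) // ltW.
  apply: right => //; rewrite ltW //= (@le_lt_trans _ _ (sup S + r / 2)) //.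
    by rewrite ge_min lexx orbT.
  by rewrite ltrD2l ltr_pdivrMr // ltr_pMr // ltr1n.
by move=> /(ub_le_sup (ex_intro _ b ubS)); rewrite leNgt Ss'.
Qed.

Definition abs_cont_on (f : R -> R) (T : R) : Prop :=
  forall e : R, 0 < e -> exists2 d : R, 0 < d &
    forall (N : nat) (u v : nat -> R),
      (forall i, (i < N)%N -> 0 <= u i /\ u i <= v i /\ v i <= T) ->
      (forall i j, (i < j)%N -> (j < N)%N -> v i <= u j) ->
      \sum_(i < N) (v i - u i) < d ->
      \sum_(i < N) `|f (v i) - f (u i)| < e.

(** Both half-neighbourhoods are needed: real induction enters a point from the
    left and leaves it to the right. *)
Lemma nonpos_derivative_local (f : R -> R) (t df e : R) :
  is_derive t 1 f df -> df <= 0 -> 0 < e -> exists2 r : R, 0 < r &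
    (forall s, t - r < s <= t -> f t - f s <= e * (t - s)) /\
    (forall s, t <= s < t + r -> f s - f t <= e * (s - t)).
Proof.
move=> fd df0 e0.
have [dfv dfe] := fd.
have /cvg_ex[l fl] := dfv.
have lE : l = df by rewrite -dfe; apply/esym/cvg_lim.
rewrite lE in fl.
move/cvgrPdist_le : fl => /(_ e e0)[r /= r0 rf].
have key h : h != 0 -> `|h| < r -> `|df - h^-1 * (f (h + t) - f t)| <= e.
  move=> h0 hr; have := rf h; rewrite /ball_ /= sub0r normrN => /(_ hr h0).
  by rewrite /GRing.scale /= mulr1.
have slope h : h != 0 -> `|h| < r -> h^-1 * (f (h + t) - f t) <= e.
  by move=> h0 /(key h h0); rewrite ler_norml => /andP[h1 _]; lra.
exists r => //; split => s /andP[s1 s2].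
  have [->|st] := eqVneq s t; first by rewrite !subrr mulr0.
  have h0 : s - t < 0 by rewrite subr_lt0 lt_neqAle st.
  have hr : `|s - t| < r by rewrite ltr0_norm //; lra.
  have := slope (s - t) (ltr0_neq0 h0) hr; rewrite subrK mulrC.
  by rewrite ler_ndivrMr // => h; lra.
have [->|st] := eqVneq s t; first by rewrite !subrr mulr0.
have h0 : 0 < s - t by rewrite subr_gt0 lt_neqAle eq_sym st.
have hr : `|s - t| < r by rewrite gtr0_norm //; lra.
have := slope (s - t) (lt0r_neq0 h0) hr; rewrite subrK mulrC.
by rewrite ler_pdivrMr.
Qed.

Let mu : measure _ _ := @lebesgue_measure R.

(** The exceptional null set is covered by an open set [O] of measure less than
    the [d] that absolute continuity gives for [e].  Moving along [0, T], the
    increment of [f] is controlled by [e] times the elapsed time near a point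
    where the derivative is nonpositive, and is charged to an interval inside
    [O] near an exceptional point; these intervals have total length less than
    [d]. *)
Lemma abs_cont_nonincreasing (f : R -> R) (T : R) : 0 <= T -> abs_cont_on f T ->
  {ae lebesgue_measure, forall t : R, 0 <= t ->
    exists2 df : R, is_derive t 1 f df & df <= 0} ->
  f T <= f 0.
Proof.
move=> T0 acf [B [mB B0 subB]].
suff key e : 0 < e -> f T - f 0 <= e * (T + 1).
  rewrite -subr_le0; apply/ler_addgt0Pl => e e0; rewrite addr0.
  have T1 : 0 < T + 1 by rewrite ltr_wpDl.
  by have := key (e / (T + 1)) (divr_gt0 e0 T1); rewrite divfK // gt_eqF.
move=> e0; have [d d0 acd] := acf e e0.
have B0' : mu B = 0%E by exact: B0.
have [|O [oO BO muOB]] := lebesgue_regularity_outer mB _ d0.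
  by rewrite -/mu B0' ltry.
have mO : measurable O by exact: measurable_realfun.open_measurable.
have muO : (mu O < d%:E)%E.
  apply: le_lt_trans muOB.
  have OE : O = B `|` (O `\` B) by rewrite setDUK.
  have : (mu O <= mu B + mu (O `\` B))%E.
    by rewrite {1}OE; apply: measureU2 => //; exact: measurableD.
  by rewrite B0' add0e.
pose E s : set R := O `&` `[0, s[.
have mE s : measurable (E s) by apply: measurableI.
have finE s : mu (E s) \is a fin_num.
  rewrite ge0_fin_numE // (@le_lt_trans _ _ (mu O)) //.
    by apply: le_measure; rewrite ?inE //; [exact: mE|exact: subIsetl].
  by rewrite (@lt_trans _ _ d%:E) // ltry.
pose mm s := fine (mu (E s)).
have mm_lt s : mm s < d.
  rewrite -lte_fin fineK //; apply: le_lt_trans muO.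
  by apply: le_measure; rewrite ?inE //; [exact: mE|exact: subIsetl].
have mm_mono s t : s <= t -> mm s <= mm t.
  move=> st; apply: fine_le; rewrite ?finE //.
  apply: le_measure; rewrite ?inE; [exact: mE|exact: mE|]; apply: setIS => z /=.
  by rewrite !in_itv /= => /andP[-> /= zs]; rewrite (lt_le_trans zs).
have mm_add s t : 0 <= s -> s <= t -> (forall z, s <= z <= t -> O z) ->
    mm t = mm s + (t - s).
  move=> s0 st stO.
  have Et : E t = E s `|` `[s, t[.
    apply/seteqP; split => z /=; rewrite /E /= !in_itv /=.
      move=> [Oz /andP[z0 zt]]; case: (ltP z s) => zs; [left|right].
        by rewrite z0.
      by rewrite zt.
    move=> [[Oz /andP[z0 zs]]|/andP[sz zt]].
      by rewrite z0 (lt_le_trans zs).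
    by split; [apply: stO; rewrite sz ltW|rewrite zt (le_trans s0)].
  have dis : [disjoint E s & `[s, t[ ].
    apply/disj_setPLR => z [_] /=; rewrite !in_itv /= => /andP[_ zs].
    by rewrite leNgt zs.
  have muU : mu (E s `|` `[s, t[) = (mu (E s) + mu `[s, t[)%E.
    by apply: measureU; [exact: mE|by []|exact/disj_set2P].
  rewrite /mm Et muU.
  have -> : mu `[s, t[ = (t - s)%:E.
    apply: (etrans (lebesgue_measure_itv `[s, t[%R)); rewrite /= lte_fin.
    by case: ltgtP st => // ->; rewrite subrr.
  by rewrite fineD ?finE.
(* [P s] : the increment of [f] over [0, s] is at most [e s] plus the variation
   of [f] over finitely many ordered intervals, whose total length is at most the
   measure of [O] below [s]. *)
pose P s := exists N (u v : nat -> R),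
  [/\ (forall i, (i < N)%N -> 0 <= u i /\ u i <= v i /\ v i <= s),
      (forall i j, (i < j)%N -> (j < N)%N -> v i <= u j),
      \sum_(i < N) (v i - u i) <= mm s &
      f s - f 0 <= e * s + \sum_(i < N) `|f (v i) - f (u i)|].
have : P T.
  apply: (@real_induction P 0 T) => //.
    exists 0%N, (fun=> 0), (fun=> 0); split => //; rewrite !big_ord0.
      by rewrite fine_ge0 // measure_ge0.
    by rewrite subrr mulr0 addr0.
  have regular s t : s <= t -> f t - f s <= e * (t - s) -> P s -> P t.
    move=> st fst [N [u [v [uv ord len inc]]]]; exists N, u, v; split => //.
    - by move=> i iN; have [? [? ?]] := uv i iN; split => //; split => //; lra.
    - by rewrite (le_trans len) // mm_mono.
    - by lra.
  have exceptional s t : 0 <= s -> s <= t -> (forall z, s <= z <= t -> O z) ->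
      P s -> P t.
    move=> s0 st stO [N [u [v [uv ord len inc]]]].
    exists N.+1, (fun i => if i == N then s else u i),
      (fun i => if i == N then t else v i).
    have sumN (F : R -> R -> R) : \sum_(i < N) F (if i == N :> nat then t else v i)
        (if i == N :> nat then s else u i) = \sum_(i < N) F (v i) (u i).
      by apply: eq_bigr => i _; rewrite ltn_eqF.
    split.
    - move=> i; rewrite ltnS leq_eqVlt; case: eqP => [->|_ /= iN]; first by [].
      by have [? [? ?]] := uv i iN; split => //; split => //; lra.
    - move=> i j ij; rewrite ltnS leq_eqVlt; case: eqP => [jN _|_ /= jN].
        rewrite jN in ij; rewrite ltn_eqF //.
        by have [_ []] := uv i ij.
      by rewrite ltn_eqF ?(ltn_trans ij) //; exact: ord.
    - rewrite big_ord_recr /= eqxx (sumN (fun a b => a - b)).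
      by rewrite (mm_add s t) // lerD2r.
    - rewrite big_ord_recr /= eqxx (sumN (fun a b => `|f a - f b|)).
      have := ler_norm (f t - f s).
      have : 0 <= e * (t - s) by rewrite mulr_ge0 ?subr_ge0 // ltW.
      by lra.
  move=> t /andP[t0 tT]; have [Bt|nBt] := pselect (B t).
    have [r /= r0 rO] : \forall z \near t, O z by apply: open_nbhs_nbhs; split => //; exact: BO.
    have inO z : `|t - z| < r -> O z by move=> zr; exact: rO.
    exists r => //; split => s.
      move=> s0 /andP[s1 s2]; apply: exceptional => // z /andP[z1 z2].
      by apply: inO; rewrite ger0_norm; lra.
    move=> sT /andP[s1 s2]; apply: exceptional => // z /andP[z1 z2].
    by apply: inO; rewrite ler0_norm; lra.
  have [df fdf df0] : exists2 df : R, is_derive t 1 f df & df <= 0.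
    by apply: contrapT => h; apply: nBt; apply: subB => /= /(_ t0).
  have [r r0 [left right]] := nonpos_derivative_local fdf df0 e0.
  exists r => //; split => s.
    by move=> s0 s1; apply: regular; [case/andP: s1|exact: left].
  by move=> sT s1; apply: regular; [case/andP: s1|exact: right].
move=> [N [u [v [uv ord len inc]]]].
apply: le_trans inc _; rewrite mulrDr mulr1 lerD2l ltW //.
by apply: acd => //; apply: le_lt_trans len _.
Qed.

End AbsCont.

(** * Closure properties of absolute continuity *)

Section AbsContCalculus.
Context {R : realType}.
Variable T : R.

(** Real induction along [0, T]: a step shorter than the [d] given for [e = 1]
    raises the bound by at most 1. *)
Lemma abs_cont_bounded (f : R -> R) : 0 <= T -> abs_cont_on f T ->
  exists2 M : R, 0 < M & forall r, 0 <= r <= T -> `|f r| <= M.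
Proof.
move=> T0 acf; have [d d0 acd] := acf 1 ltr01.
have step s t : 0 <= s -> s <= t -> t <= T -> t - s < d -> `|f t - f s| < 1.
  move=> s0 st tT tsd; have := acd 1%N (fun=> s) (fun=> t).
  rewrite !big_ord1; apply => //.
  by move=> i j ij; rewrite ltnS leqn0 => /eqP j0; rewrite j0 in ij.
pose P s := exists2 M : R, 0 < M & forall r, 0 <= r <= s -> `|f r| <= M.
have grow s t : 0 <= s -> s <= t -> t <= T -> t - s < d -> P s -> P t.
  move=> s0 st tT tsd [M M0 bM]; exists (M + 1) => [|r /andP[r0 rt]].
    by rewrite ltr_wpDr.
  have [rs|sr] := leP r s; first by rewrite (le_trans (bM r _)) ?r0 // lerDl.
  have h1 : `|f r - f s| < 1 by apply: step; lra.
  have h2 : `|f s| <= M by apply: bM; rewrite s0 lexx.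
  by rewrite -(subrK (f s) (f r)) (le_trans (ler_normD _ _)) //; lra.
apply: (@real_induction _ P 0 T) => //.
  exists (`|f 0| + 1) => [|r]; first by rewrite ltr_wpDl.
  by move=> /le_anti <-; rewrite lerDl.
move=> t /andP[t0 tT]; exists d => //; split => s.
  by move=> s0 /andP[s1 s2]; apply: grow => //; lra.
by move=> sT /andP[s1 s2]; apply: grow => //; lra.
Qed.

Lemma abs_cont_dominated (f g h : R -> R) (K : R) : 0 < K ->
  (forall s t, 0 <= s -> s <= t -> t <= T ->
     `|f t - f s| <= K * (`|g t - g s| + `|h t - h s|)) ->
  abs_cont_on g T -> abs_cont_on h T -> abs_cont_on f T.
Proof.
move=> K0 dom acg ach e e0.
have e' : 0 < e / (K * 2) by rewrite divr_gt0 ?mulr_gt0.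
have [d1 d10 P1] := acg _ e'; have [d2 d20 P2] := ach _ e'.
exists (Num.min d1 d2) => [|N u v uv ord]; first by rewrite lt_min d10.
rewrite lt_min => /andP[l1 l2].
have := P1 N u v uv ord l1; have := P2 N u v uv ord l2.
set S2 := \sum_(_ < _) _; set S1 := \sum_(_ < _) _ => h2 h1.
apply: (@le_lt_trans _ _ (K * (S1 + S2))).
  rewrite /S1 /S2 -big_split mulr_sumr /=; apply: ler_sum => i _.
  by have [? [? ?]] := uv i (ltn_ord i); apply: dom.
have -> : e = K * (e / (K * 2) + e / (K * 2)).
  by field; rewrite gt_eqF.
by rewrite ltr_pM2l // ltrD.
Qed.

Lemma abs_cont_id : abs_cont_on (fun t => t) T.
Proof.
move=> e e0; exists e => // N u v uv _; apply: le_lt_trans.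
apply: ler_sum => i _; have [_ [h _]] := uv i (ltn_ord i).
by rewrite ger0_norm // subr_ge0.
Qed.

Lemma abs_cont_cst c : abs_cont_on (fun=> c) T.
Proof.
by move=> e e0; exists 1 => // N u v _ _ _; rewrite subrr normr0 big1.
Qed.

Lemma abs_contD f g : abs_cont_on f T -> abs_cont_on g T ->
  abs_cont_on (fun t => f t + g t) T.
Proof.
apply: (@abs_cont_dominated _ _ _ 1) => // s t _ _ _; rewrite mul1r.
by rewrite opprD addrACA ler_normD.
Qed.

Lemma abs_contM f g : 0 <= T -> abs_cont_on f T -> abs_cont_on g T ->
  abs_cont_on (fun t => f t * g t) T.
Proof.
move=> T0 acf acg.
have [M M0 fM] := abs_cont_bounded T0 acf.
have [M' M'0 gM] := abs_cont_bounded T0 acg.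
apply: (@abs_cont_dominated _ f g (M + M')) => //; first by rewrite addr_gt0.
move=> s t s0 st tT.
have -> : f t * g t - f s * g s = (f t - f s) * g t + f s * (g t - g s) by ring.
rewrite (le_trans (ler_normD _ _)) // !normrM mulrDr lerD //.
  rewrite mulrC ler_wpM2r // (le_trans (gM _ _)) ?tT ?(le_trans s0) //.
  by rewrite lerDr ltW.
rewrite ler_wpM2r // (le_trans (fM _ _)) ?s0 ?(le_trans st) //.
by rewrite lerDl ltW.
Qed.

Lemma abs_cont_sum (I : Type) (r : seq I) (F : I -> R -> R) :
  (forall i, abs_cont_on (F i) T) ->
  abs_cont_on (fun t => \sum_(i <- r) F i t) T.
Proof.
move=> acF; elim: r => [|i r IH].
  rewrite (_ : (fun t => _) = fun=> 0); first exact: abs_cont_cst.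
  by apply/funext => t; rewrite big_nil.
rewrite (_ : (fun t => _) = fun t => F i t + \sum_(j <- r) F j t).
  exact: abs_contD.
by apply/funext => t; rewrite big_cons.
Qed.

(** On [0, T] the function is Lipschitz with constant [c exp (c T)], by
    [1 - h <= exp (- h)]. *)
Lemma abs_cont_expR c : 0 < c -> abs_cont_on (fun t => expR (c * t)) T.
Proof.
move=> c0; apply: (@abs_cont_dominated _ id (fun=> 0) (expR (c * T) * c)).
- by rewrite mulr_gt0 // expR_gt0.
- move=> s t s0 st tT /=; rewrite subrr normr0 addr0 [`|t - s|]ger0_norm ?subr_ge0 //.
  rewrite ger0_norm; last by rewrite subr_ge0 ler_expR ler_pM2l.
  have -> : c * s = c * t + - (c * (t - s)) by ring.
  rewrite expRD -{1}(mulr1 (expR (c * t))) -mulrBr -mulrA.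
  have h : 1 - expR (- (c * (t - s))) <= c * (t - s).
    by have := expR_ge1Dx (- (c * (t - s))); lra.
  apply: (@le_trans _ _ (expR (c * t) * (c * (t - s)))).
    by rewrite ler_pM2l ?expR_gt0.
  by rewrite ler_wpM2r ?ler_expR ?ler_pM2l // mulr_ge0 ?subr_ge0 // ltW.
- exact: abs_cont_id.
- exact: abs_cont_cst.
Qed.

End AbsContCalculus.

Section Coordinates.
Context {R : realType}.

(** Working with coordinates reduces vector trajectories to the scalar theory:
    the Lyapunov function is a polynomial in the coordinates. *)
Definition coord_abs_cont k (x : R -> 'cV[R]_k) (T : R) : Prop :=
  forall i, abs_cont_on (fun t => x t i 0) T.

Definition coord_derive k (x : R -> 'cV[R]_k) (t : R) (dx : 'cV[R]_k) : Prop :=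
  forall i, is_derive t 1 (fun s => x s i 0) (dx i 0).

Lemma locally_abs_continuous_coord k (x : R -> 'cV[R]_k) T : 0 <= T ->
  locally_abs_continuous x -> coord_abs_cont x T.
Proof.
move=> T0 acx i e e0; have [d d0 P] := acx T T0 e e0.
exists d => // N u v uv ord len.
apply: le_lt_trans (P N (fun i => u i) (fun i => v i) _ _ len).
- apply: ler_sum => j _; rewrite [leRHS]/Num.Def.normr /= mx_normrE.
  apply: le_trans; last exact: (le_bigmax _ _ (i, 0)).
  by rewrite !mxE.
- by move=> j; exact: uv.
- by move=> a b ab; exact: ord.
Qed.

Lemma is_derive_coord k (x : R -> 'cV[R]_k) (t : R) (dx : 'cV[R]_k) :
  is_derive t 1 x dx -> coord_derive x t dx.
Proof.
move=> [dfx dxE] i; split; first exact: (derivable_mxP _ _ _).1.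
by rewrite -dxE derive_mx // mxE.
Qed.

Lemma coord_derive_cst k (c : 'cV[R]_k) (t : R) : coord_derive (fun=> c) t 0.
Proof. by move=> i; rewrite mxE; exact: is_derive_cst. Qed.

Lemma coord_deriveB k (x y : R -> 'cV[R]_k) (t : R) dx dy :
  coord_derive x t dx -> coord_derive y t dy ->
  coord_derive (fun s => x s - y s) t (dx - dy).
Proof.
move=> dxt dyt i; rewrite !mxE.
rewrite (_ : (fun s => _) = (fun s => x s i 0) - (fun s => y s i 0)).
  exact: is_deriveB.
by apply/funext => s; rewrite !mxE.
Qed.

Lemma is_derive_bigsum (I : Type) (r : seq I) (F : I -> R -> R) (dF : I -> R) (t : R) :
  (forall i, is_derive t 1 (F i) (dF i)) ->
  is_derive t 1 (fun s => \sum_(i <- r) F i s) (\sum_(i <- r) dF i).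
Proof.
move=> h; elim: r => [|i r IH].
  rewrite big_nil (_ : (fun s => _) = cst 0); first exact: is_derive_cst.
  by apply/funext => s; rewrite big_nil.
rewrite big_cons (_ : (fun s => _) = F i + (fun s => \sum_(j <- r) F j s)).
  exact: is_deriveD.
by apply/funext => s; rewrite big_cons.
Qed.

Lemma coord_derive_mulmx p k (M : 'M[R]_(p, k)) (x : R -> 'cV[R]_k) (t : R) dx :
  coord_derive x t dx -> coord_derive (fun s => M *m x s) t (M *m dx).
Proof.
move=> dxt i; under eq_fun do rewrite mxE; rewrite mxE.
apply: is_derive_bigsum => j; exact: is_deriveZ.
Qed.

Lemma is_derive_dot k (x y : R -> 'cV[R]_k) (t : R) dx dy :
  coord_derive x t dx -> coord_derive y t dy ->
  is_derive t 1 (fun s => dot (x s) (y s)) (dot (x t) dy + dot dx (y t)).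
Proof.
move=> dxt dyt; rewrite /dot -big_split /=; apply: is_derive_bigsum => i.
rewrite [dx i 0 * _]mulrC; exact: is_deriveM.
Qed.

Lemma coord_abs_cont_cst k (c : 'cV[R]_k) T : coord_abs_cont (fun=> c) T.
Proof. by move=> i; exact: abs_cont_cst. Qed.

Lemma coord_abs_contB k (x y : R -> 'cV[R]_k) T :
  coord_abs_cont x T -> coord_abs_cont y T ->
  coord_abs_cont (fun s => x s - y s) T.
Proof.
move=> acx acy i.
apply: (@abs_cont_dominated _ _ _ (fun s => x s i 0) (fun s => y s i 0) 1) => //.
move=> s t _ _ _; rewrite mul1r !mxE.
have -> : x t i 0 - y t i 0 - (x s i 0 - y s i 0)
  = (x t i 0 - x s i 0) - (y t i 0 - y s i 0) by ring.
exact: ler_normB.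
Qed.

Lemma coord_abs_cont_mulmx p k (M : 'M[R]_(p, k)) (x : R -> 'cV[R]_k) T :
  0 <= T -> coord_abs_cont x T -> coord_abs_cont (fun s => M *m x s) T.
Proof.
move=> T0 acx i.
rewrite (_ : (fun s => _) = fun s => \sum_j M i j * x s j 0).
  apply: abs_cont_sum => j.
  by apply: (@abs_contM _ _ (fun=> M i j)) => //; exact: abs_cont_cst.
by apply/funext => s; rewrite mxE.
Qed.

Lemma abs_cont_dot k (x y : R -> 'cV[R]_k) T : 0 <= T ->
  coord_abs_cont x T -> coord_abs_cont y T ->
  abs_cont_on (fun s => dot (x s) (y s)) T.
Proof. by move=> T0 acx acy; apply: abs_cont_sum => j; exact: abs_contM. Qed.

Lemma ae_weaken (P Q : R -> Prop) : (forall t, P t -> Q t) ->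
  {ae lebesgue_measure, forall t : R, P t} ->
  {ae lebesgue_measure, forall t : R, Q t}.
Proof. by move=> PQ; apply: negligibleS => t /= nQ Pt; apply/nQ/PQ. Qed.

Lemma abs_cont_constant (f : R -> R) (T : R) : 0 <= T -> abs_cont_on f T ->
  {ae lebesgue_measure, forall t : R, 0 <= t -> is_derive t 1 f 0} -> f T = f 0.
Proof.
move=> T0 acf df0; apply/eqP; rewrite eq_le; apply/andP; split.
  apply: abs_cont_nonincreasing => //.
  by apply: ae_weaken df0 => t h t0; exists 0 => //; exact: h.
rewrite -lerN2; apply: (@abs_cont_nonincreasing _ (fun t => - f t)) => //.
  apply: (@abs_cont_dominated _ _ _ f (fun=> 0) 1) => //; last exact: abs_cont_cst.
  by move=> s t _ _ _; rewrite subrr normr0 addr0 mul1r -opprD normrN.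
apply: ae_weaken df0 => t h t0; exists 0 => //; rewrite -oppr0.
by apply: is_deriveN; exact: h.
Qed.

Lemma coord_abs_cont_constant k (x : R -> 'cV[R]_k) :
  (forall T, 0 <= T -> coord_abs_cont x T) ->
  {ae lebesgue_measure, forall t : R, 0 <= t -> coord_derive x t 0} ->
  forall t, 0 <= t -> x t = x 0.
Proof.
move=> acx dx0 t t0; apply/colP => i.
apply: (@abs_cont_constant (fun s => x s i 0)) => //; first exact: acx.
apply: ae_weaken dx0 => s h s0.
by have := h s0 i; rewrite mxE.
Qed.

(** Gronwall's argument: [exp (c t) V t] is nonincreasing. *)
Lemma exponential_decay (V dV : R -> R) (c : R) : 0 < c ->
  (forall T, 0 <= T -> abs_cont_on V T) ->
  {ae lebesgue_measure, forall t : R, 0 <= t ->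
     is_derive t 1 V (dV t) /\ dV t <= - c * V t} ->
  forall t, 0 <= t -> V t <= V 0 * expR (- c * t).
Proof.
move=> c0 acV dVle t t0.
have : expR (c * t) * V t <= expR (c * 0) * V 0.
  apply: (@abs_cont_nonincreasing _ (fun t => expR (c * t) * V t)) => //.
    by apply: abs_contM => //; [exact: abs_cont_expR | exact: acV].
  apply: ae_weaken dVle => s h s0; have [dVs le] := h s0.
  have dlin : is_derive s 1 (fun r => c * r) (c *: 1) by apply: is_deriveZ.
  have dexp : is_derive s 1 (expR \o (fun r => c * r)) (expR (c * s) * (c *: 1)).
    exact: is_derive1_comp.
  exists (expR (c * s) *: dV s + V s *: (expR (c * s) * (c *: 1))).
    exact: (is_deriveM dexp dVs).
  rewrite /GRing.scale /= mulr1.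
  have -> : expR (c * s) * dV s + V s * (expR (c * s) * c)
    = expR (c * s) * (dV s - - c * V s) by ring.
  by rewrite pmulr_rle0 ?expR_gt0 // subr_le0.
rewrite mulr0 expR0 mul1r mulNr expRN => h.
by rewrite ler_pdivlMr ?expR_gt0 // mulrC.
Qed.

End Coordinates.

(** * Block vectors and Kronecker products *)

Lemma sum_blocks (n m : nat) (V : nmodType) (F : 'I_(n * m) -> V) :
  \sum_k F k = \sum_i \sum_p F (mxtens_index (i, p)).
Proof.
rewrite pair_big /= (reindex (@mxtens_index n m)) /=.
  by apply: eq_bigr => -[].
by exists (@mxtens_unindex n m) => k _; rewrite (mxtens_indexK, mxtens_unindexK).
Qed.

Section Blocks.
Context {R : realType} {n m : nat}.
Implicit Types (z : 'cV[R]_(n * m)) (v : 'cV[R]_m) (w : 'cV[R]_n).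

(** The matrix [1^T (x) I], with [m] rows instead of the [1 * m] of the transpose
    of [ones_kron].  Its transpose replicates a vector [n] times. *)
Definition blocksum : 'M[R]_(m, n * m) :=
  \matrix_(p, k) ((mxtens_unindex k).2 == p)%:R.

(** A vector of [R^(nm)] is an [n] by [m] array.  Its blocks are the rows, on
    which block-diagonal matrices act; its slices are the columns, on which
    [K (x) I] acts. *)
Definition block z i : 'cV[R]_m := \col_p z (mxtens_index (i, p)) 0.

Definition slice z p : 'cV[R]_n := \col_i z (mxtens_index (i, p)) 0.

Definition kron w v : 'cV[R]_(n * m) :=
  \col_k (w (mxtens_unindex k).1 0 * v (mxtens_unindex k).2 0).

Lemma blocksumE z : blocksum *m z = \sum_i block z i.
Proof.
apply/colP => p; rewrite mxE sum_blocks summxE; apply: eq_bigr => i _.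
rewrite (bigD1 p) //= big1 => [|q qp]; rewrite !mxE mxtens_indexK /=.
  by rewrite eqxx mul1r addr0.
by rewrite (negPf qp) mul0r.
Qed.

Lemma blocksum_slice z p : (blocksum *m z) p 0 = \sum_i slice z p i 0.
Proof. by rewrite blocksumE summxE; apply: eq_bigr => i _; rewrite !mxE. Qed.

Lemma block_rep v i : block (blocksum^T *m v) i = v.
Proof.
apply/colP => p; rewrite !mxE (bigD1 p) //= big1 => [|q qp].
  by rewrite !mxE mxtens_indexK eqxx mul1r addr0.
by rewrite !mxE mxtens_indexK /= eq_sym (negPf qp) mul0r.
Qed.

Lemma block_inj z z' : (forall i, block z i = block z' i) -> z = z'.
Proof.
move=> zz'; apply/colP => k; case: (mxtens_indexP k) => i p.
by have /colP/(_ p) := zz' i; rewrite !mxE.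
Qed.

Lemma block_kron w v i : block (kron w v) i = w i 0 *: v.
Proof. by apply/colP => p; rewrite !mxE mxtens_indexK. Qed.

Lemma slice_kron w v p : slice (kron w v) p = v p 0 *: w.
Proof. by apply/colP => i; rewrite !mxE mxtens_indexK mulrC. Qed.

Lemma replicateE v : replicate n v = blocksum^T *m v.
Proof.
apply: block_inj => i; rewrite block_rep; apply/colP => p.
rewrite !mxE mxtens_indexK mul1r; congr (v _ _); exact/val_inj.
Qed.

Lemma dot_slice z z' : dot z z' = \sum_p dot (slice z p) (slice z' p).
Proof.
rewrite /dot sum_blocks exchange_big; apply: eq_bigr => p _.
by apply: eq_bigr => i _; rewrite !mxE.
Qed.

Lemma blocksum_rep : blocksum *m blocksum^T = n%:R%:M.
Proof.
apply/matrixP => p q; rewrite mxE sum_blocks.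
under eq_bigr => i _.
  rewrite (bigD1 p) //= big1 => [|r rp]; last first.
    by rewrite !mxE mxtens_indexK /= (negPf rp) mul0r.
  rewrite !mxE mxtens_indexK eqxx mul1r addr0; over.
by rewrite sumr_const card_ord !mxE -mulrnA mulnC mulrnA.
Qed.

Lemma ones_kronE : ones_kron R n m *m (ones_kron R n m)^T = blocksum^T *m blocksum.
Proof.
apply/matrixP => k l; rewrite [LHS]mxE [RHS]mxE sum_blocks big_ord1.
by apply: eq_bigr => p _; rewrite !mxE mxtens_indexK !mul1r.
Qed.

Lemma ones_kron_tr z z' : (ones_kron R n m)^T *m z = (ones_kron R n m)^T *m z' ->
  blocksum *m z = blocksum *m z'.
Proof.
have entry y p : ((ones_kron R n m)^T *m y) (mxtens_index (0, p)) 0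
    = (blocksum *m y) p 0.
  rewrite !mxE; apply: eq_bigr => k _; congr (_ * _).
  by rewrite !mxE mxtens_indexK /= mul1r.
by move=> Uzz'; apply/colP => p; rewrite -!entry Uzz'.
Qed.

Section Blkdiag.
Variable As : 'I_n -> 'M[R]_m.

Lemma block_blkdiag z i : block (blkdiag As *m z) i = As i *m block z i.
Proof.
apply/colP => p; rewrite !mxE sum_blocks (bigD1 i) //= [X in _ + X]big1.
  by rewrite addr0; apply: eq_bigr => q _; rewrite !mxE !mxtens_indexK /= eqxx.
move=> j ji; rewrite big1 // => q _.
by rewrite !mxE !mxtens_indexK /= eq_sym (negPf ji) mul0r.
Qed.

Lemma blocksum_blkdiag_rep v :
  blocksum *m (blkdiag As *m (blocksum^T *m v)) = (\sum_i As i) *m v.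
Proof.
rewrite blocksumE mulmx_suml; apply: eq_bigr => i _.
by rewrite block_blkdiag block_rep.
Qed.

Lemma blocksum_blkdiag_kron w v :
  blocksum *m (blkdiag As *m kron w v) = (\sum_i w i 0 *: As i) *m v.
Proof.
rewrite blocksumE mulmx_suml; apply: eq_bigr => i _.
by rewrite block_blkdiag block_kron -scalemxAr scalemxAl.
Qed.

End Blkdiag.

Lemma blocksum_stack (bs : 'I_n -> 'cV[R]_m) : blocksum *m stack bs = \sum_i bs i.
Proof.
rewrite blocksumE; apply: eq_bigr => i _.
by apply/colP => p; rewrite !mxE mxtens_indexK.
Qed.

Lemma slice_tens (K : 'M[R]_n) z p :
  slice ((K *t (1%:M : 'M[R]_m)) *m z) p = K *m slice z p.
Proof.
apply/colP => i; rewrite !mxE sum_blocks; apply: eq_bigr => j _.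
rewrite (bigD1 p) //= big1 => [|q qp]; rewrite tensmxE !mxE.
  by rewrite eqxx mulr1 addr0.
by rewrite eq_sym (negPf qp) mulr0 mul0r.
Qed.

Lemma slice_inj z z' : (forall p, slice z p = slice z' p) -> z = z'.
Proof.
move=> zz'; apply/colP => k; case: (mxtens_indexP k) => i p.
by have /colP/(_ i) := zz' p; rewrite !mxE.
Qed.

Lemma slice_rep v p : slice (blocksum^T *m v) p = v p 0 *: const_mx 1.
Proof.
apply/colP => i; have /colP/(_ p) := block_rep v i.
by rewrite /block /slice mxE => vE; rewrite mxE vE !mxE mulr1.
Qed.

Lemma dot_tens (K : 'M[R]_n) z :
  dot z ((K *t (1%:M : 'M[R]_m)) *m z) = \sum_p dot (slice z p) (K *m slice z p).
Proof. by rewrite dot_slice; apply: eq_bigr => p _; rewrite slice_tens. Qed.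

End Blocks.

(** * Laplacians of weight-balanced digraphs *)

Section Laplacian.
Context {R : realType} {n : nat}.
Implicit Types (G : wdigraph R n) (w : 'cV[R]_n).

Lemma adj_ge0 G i j : 0 <= adj G i j.
Proof.
by have [/adj_gt0/ltW//|/adj_eq0 ->] := boolP (edge G i j).
Qed.

Lemma laplacianE G i j :
  laplacian G i j = (i == j)%:R * (\sum_k adj G k i) - adj G i j.
Proof. by rewrite !mxE mulr_natl; case: eqP => [->|]. Qed.

Lemma sum_deltal (i : 'I_n) (F : 'I_n -> R) : \sum_j (j == i)%:R * F j = F i.
Proof.
rewrite (bigD1 i) //= big1 => [|j ji]; last by rewrite (negPf ji) mul0r.
by rewrite eqxx mul1r addr0.
Qed.

Lemma sum_deltar (i : 'I_n) (F : 'I_n -> R) : \sum_j (i == j)%:R * F j = F i.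
Proof. by under eq_bigr do rewrite eq_sym; rewrite sum_deltal. Qed.

Lemma laplacian_col_sum G j : \sum_i laplacian G i j = 0.
Proof.
by under eq_bigr do rewrite laplacianE; rewrite sumrB sum_deltal subrr.
Qed.

Lemma balancedE G : weight_balanced G ->
  forall i, \sum_j adj G i j = \sum_j adj G j i.
Proof. by move=> /matrixP balG i; have := balG i i; rewrite !mxE eqxx. Qed.

Lemma laplacian_row_sum G : weight_balanced G ->
  forall i, \sum_j laplacian G i j = 0.
Proof.
move=> balG i; under eq_bigr do rewrite laplacianE.
by rewrite sumrB (sum_deltar i (fun=> _)) balancedE // subrr.
Qed.

(** The Dirichlet form: the symmetrised Laplacian sums the squared differences
    along the edges, because in- and out-degrees agree. *)
Lemma laplacian_quad G w : weight_balanced G ->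
  dot w ((laplacian G + (laplacian G)^T) *m w)
  = \sum_i \sum_j adj G i j * (w i 0 - w j 0) ^+ 2.
Proof.
move=> balG.
pose S1 := \sum_i \sum_j adj G i j * w i 0 ^+ 2.
pose S2 := \sum_i \sum_j adj G i j * w j 0 ^+ 2.
pose X := \sum_i \sum_j adj G i j * (w i 0 * w j 0).
have S12 : S1 = S2.
  rewrite /S2 exchange_big; apply: eq_bigr => i _ /=.
  by rewrite -!mulr_suml balancedE.
have Lw : dot w (laplacian G *m w) = S1 - X.
  rewrite -sumrB; apply: eq_bigr => i _; rewrite mxE.
  under eq_bigr do rewrite laplacianE mulrBl -mulrA.
  rewrite !sumrB sum_deltar mulrBr; congr (_ - _).
    by rewrite -mulr_suml balancedE //; ring.
  by rewrite mulr_sumr; apply: eq_bigr => j _; ring.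
rewrite mulmxDl dotDr -dot_mulmx [dot (_ *m _) _]dotC Lw {2}S12.
rewrite /S1 /S2 /X -!sumrB -big_split; apply: eq_bigr => i _ /=.
rewrite -!sumrB -big_split; apply: eq_bigr => j _ /=; ring.
Qed.

Lemma laplacian_psd G w : weight_balanced G ->
  0 <= dot w ((laplacian G + (laplacian G)^T) *m w).
Proof.
move=> balG; rewrite laplacian_quad //; apply: sumr_ge0 => i _.
by apply: sumr_ge0 => j _; rewrite mulr_ge0 ?adj_ge0 ?sqr_ge0.
Qed.

(** Each term of the Dirichlet form vanishes, so [w] is constant along edges and,
    by connectivity, everywhere. *)
Lemma laplacian_quad_eq0 G w : weight_balanced G -> strongly_connected G ->
  dot w ((laplacian G + (laplacian G)^T) *m w) = 0 ->
  forall i j, w i 0 = w j 0.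
Proof.
move=> balG conG; rewrite laplacian_quad // => /eqP.
have pos i j : 0 <= adj G i j * (w i 0 - w j 0) ^+ 2.
  by rewrite mulr_ge0 ?adj_ge0 ?sqr_ge0.
rewrite psumr_eq0 => [/allP wE i j|i _]; last by apply: sumr_ge0.
have edgeE a b : edge G a b -> w a 0 = w b 0.
  move=> ab; have := wE a (mem_index_enum _); rewrite /= psumr_eq0 //.
  move=> /allP/(_ b (mem_index_enum _)); rewrite /= mulf_eq0.
  by rewrite gt_eqF ?adj_gt0 //= sqrf_eq0 subr_eq0 => /eqP.
have [->//|ij] := eqVneq i j.
have /connectP[p ep ->] := conG i j ij.
elim: p i ep {ij} => [//|b p IH] i /= /andP[ib bp].
by rewrite (edgeE _ _ ib) IH.
Qed.

Lemma laplacian_sym_const G w : weight_balanced G ->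
  (forall i j, w i 0 = w j 0) -> (laplacian G + (laplacian G)^T) *m w = 0.
Proof.
move=> balG wc; apply/colP => i; rewrite [LHS]mxE [RHS]mxE.
under eq_bigr => j _ do rewrite (wc j i) [X in X * _]mxE [X in _ + X]mxE.
by rewrite -mulr_suml big_split /= laplacian_row_sum // laplacian_col_sum addr0 mul0r.
Qed.

(** Since [(w_i - w_j)^2 <= 2 (w_i^2 + w_j^2)], the Dirichlet form is at most
    [4 n a |w|^2]. *)
Lemma lambda2_laplacian_le G a : weight_balanced G -> (forall i j, adj G i j < a) ->
  forall c w, w != 0 -> (laplacian G + (laplacian G)^T) *m w = c *: w ->
  c <= 4 * n%:R * a.
Proof.
move=> balG Ga c w w0 Lw; have ww := dot_gt0 w0.
rewrite -(ler_pM2r ww) -dotZr -Lw laplacian_quad //.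
have -> : 4 * n%:R * a * dot w w
    = \sum_(i < n) \sum_(j < n) a * (2 * (w i 0 ^+ 2 + w j 0 ^+ 2)).
  have S1 : \sum_(i < n) \sum_(j < n) w i 0 ^+ 2 = n%:R * dot w w.
    rewrite mulr_sumr; apply: eq_bigr => i _.
    by rewrite sumr_const card_ord -[LHS]mulr_natl expr2.
  have S2 : \sum_(i < n) \sum_(j < n) w j 0 ^+ 2 = n%:R * dot w w.
    by rewrite exchange_big /= S1.
  under eq_bigr do rewrite -mulr_sumr -mulr_sumr big_split /=.
  by rewrite -mulr_sumr -mulr_sumr big_split /= S1 S2; ring.
apply: ler_sum => i _; apply: ler_sum => j _.
apply: ler_pM; [exact: adj_ge0|exact: sqr_ge0|exact/ltW|].
have -> : 2 * (w i 0 ^+ 2 + w j 0 ^+ 2)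
    = (w i 0 - w j 0) ^+ 2 + (w i 0 + w j 0) ^+ 2 by ring.
by rewrite lerDl sqr_ge0.
Qed.

(** The null space of the symmetrised Laplacian is spanned by the constant
    vectors, so orthogonality to it means having zero sum. *)
Lemma lambda2_laplacian G : (1 < n)%N -> weight_balanced G -> strongly_connected G ->
  let Ls := laplacian G + (laplacian G)^T in
  [/\ 0 < lambda2 Ls,
      exists2 w : 'cV[R]_n, w != 0 & Ls *m w = lambda2 Ls *: w &
      forall w : 'cV[R]_n, \sum_i w i 0 = 0 ->
        lambda2 Ls * dot w w <= dot w (Ls *m w)].
Proof.
move=> n1 balG conG Ls.
have symLs : Ls^T = Ls by rewrite /Ls linearD /= trmxK addrC.
have Ls0 : Ls != 0.
  apply/eqP => Ls0; have i0 : 'I_n := Ordinal (ltnW n1).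
  have := @laplacian_quad_eq0 G (delta_mx (Ordinal (ltnW n1)) 0) balG conG.
  rewrite -/Ls Ls0 mul0mx dot0r => /(_ erefl (Ordinal (ltnW n1)) (Ordinal n1)).
  by rewrite !mxE /= => /eqP; rewrite oner_eq0.
have [l0 lw lP] := lambda2P symLs (fun w => laplacian_psd w balG) Ls0.
split=> // w w0; apply: lP => v Lv.
have vc := @laplacian_quad_eq0 G v balG conG; rewrite -/Ls Lv dot0r in vc.
rewrite /dot; under eq_bigr => i _ do rewrite (vc erefl i (Ordinal n1)).
by rewrite -mulr_sumr w0 mulr0.
Qed.

End Laplacian.

Section BlockLaplacian.
Context {R : realType} {n m : nat}.
Implicit Types (G : wdigraph R n) (z : 'cV[R]_(n * m)).

Lemma block_laplacian_sym G :
  block_laplacian (m := m) G + (block_laplacian G)^T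
  = (laplacian G + (laplacian G)^T) *t (1%:M : 'M[R]_m).
Proof.
rewrite /block_laplacian trmx_tens trmx1; apply/matrixP => k l.
case: (mxtens_indexP k) => i p; case: (mxtens_indexP l) => j q.
by rewrite [LHS]mxE !tensmxE [X in _ = X * _]mxE mulrDl.
Qed.

Lemma blocksum_laplacian G z : blocksum *m (block_laplacian G *m z) = 0.
Proof.
apply/colP => p; rewrite blocksum_slice slice_tens [RHS]mxE.
under eq_bigr do rewrite mxE; rewrite exchange_big big1 // => j _.
by rewrite -mulr_suml laplacian_col_sum mul0r.
Qed.

Lemma laplacian_rep G (v : 'cV[R]_m) : weight_balanced G ->
  block_laplacian G *m (blocksum^T *m v) = 0.
Proof.
move=> balG; apply: slice_inj => p; rewrite slice_tens slice_rep -scalemxAr.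
apply/colP => i; rewrite !mxE; under eq_bigr do rewrite [const_mx 1 _ _]mxE mulr1.
by rewrite laplacian_row_sum // mulr0.
Qed.

Lemma dot_block_laplacian G z :
  2 * dot z (block_laplacian G *m z)
  = dot z ((block_laplacian G + (block_laplacian G)^T) *m z).
Proof. by rewrite mulmxDl dotDr -dot_mulmx [dot (_ *m _) _]dotC; ring. Qed.

Lemma block_laplacian_psd G z : weight_balanced G ->
  0 <= dot z (block_laplacian G *m z).
Proof.
move=> balG; rewrite -(pmulr_rge0 _ (ltr0n R 2)) dot_block_laplacian.
rewrite block_laplacian_sym dot_tens; apply: sumr_ge0 => p _.
exact: laplacian_psd.
Qed.

(** The scalar inequality holds for each of the [m] slices. *)
Lemma block_laplacian_ge G z : (1 < n)%N -> weight_balanced G ->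
  strongly_connected G -> blocksum *m z = 0 ->
  lambda2 (laplacian G + (laplacian G)^T) * dot z z
  <= 2 * dot z (block_laplacian G *m z).
Proof.
move=> n1 balG conG z0; have [_ _ lP] := lambda2_laplacian n1 balG conG.
rewrite dot_block_laplacian block_laplacian_sym dot_tens dot_slice mulr_sumr.
apply: ler_sum => p _; apply: lP.
by rewrite -blocksum_slice z0 mxE.
Qed.

Lemma block_laplacian_eq0 G z : (0 < n)%N -> weight_balanced G ->
  strongly_connected G -> dot z (block_laplacian G *m z) = 0 ->
  exists v : 'cV[R]_m, z = blocksum^T *m v.
Proof.
move=> n0 balG conG zz; have := dot_block_laplacian G z.
rewrite zz mulr0 block_laplacian_sym dot_tens => /esym/eqP.
rewrite psumr_eq0 => [/allP zE|p _]; last exact: laplacian_psd.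
exists (block z (Ordinal n0)); apply: slice_inj => p; rewrite slice_rep.
have /eqP/(laplacian_quad_eq0 balG conG) zc := zE p (mem_index_enum _).
by apply/colP => i; rewrite (zc i (Ordinal n0)) !mxE mulr1.
Qed.

End BlockLaplacian.

(** * The quadratic forms defined by [Q11] and [Q12] *)

Section NullSpace.
Context {R : realType}.

(** Over the reals [A] and [A A^T] have the same range, so [A r = A A^T d] for
    some [d]; then [r - A^T d] lies in the null space and [A^T d] is orthogonal
    to it. *)
Lemma null_space_proj p k (A : 'M[R]_(p, k)) (r : 'cV[R]_k) :
  exists2 v : 'cV[R]_k, A *m v = 0 &
    forall u, A *m u = 0 -> dot u (r - v) = 0.
Proof.
have AtC : A^T *m cokermx (A *m A^T) = 0.
  set C := cokermx _; have CK : A *m A^T *m C = 0 by exact: mulmx_coker.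
  apply/matrixP => i j.
  have ACj : A^T *m (C *m delta_mx j 0) = 0 :> 'cV[R]_k.
    apply: dot_eq0; rewrite dot_mulmx trmxK (mulmxA A) (mulmxA _ C) CK.
    by rewrite mul0mx dot0r.
  by have /colP/(_ i) := ACj; rewrite mulmxA -colE !mxE.
have /submxP[D DE] : ((A *m r)^T <= A *m A^T)%MS.
  by rewrite submxE trmx_mul -mulmxA AtC mulmx0.
have AE : A *m r = A *m (A^T *m D^T).
  by rewrite -[LHS]trmxK DE !trmx_mul trmxK mulmxA.
exists (r - A^T *m D^T); first by rewrite mulmxBr -AE subrr.
move=> u Au; rewrite opprB addrC subrK.
by rewrite -dot_mulmx Au dot0l.
Qed.

Lemma injective_unitmx k (A : 'M[R]_k) :
  (forall v : 'cV[R]_k, A *m v = 0 -> v = 0) -> A \in unitmx.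
Proof.
move=> injA; rewrite -unitmx_tr -row_free_unit -kermx_eq0; apply/eqP/row_matrixP => i.
rewrite row0; apply: (can_inj trmxK); rewrite trmx0; apply: injA.
by rewrite -{1}[A]trmxK -trmx_mul -row_mul mulmx_ker row0 trmx0.
Qed.

End NullSpace.

Section Forms.
Context {R : realType} {n m : nat}.
Variables (As : 'I_n -> 'M[R]_m) (alpha beta : R) (G : wdigraph R n).
Hypotheses (alpha0 : 0 < alpha) (beta0 : 0 < beta).
Hypotheses (n1 : (1 < n)%N) (balG : weight_balanced G) (conG : strongly_connected G).
Hypothesis nullA : forall (i : 'I_n) (v : 'cV[R]_m),
  (\sum_j As j) *m v = 0 -> As i *m v = 0.

Let A := \sum_i As i.
Let bA := blkdiag As.
Let S := @blocksum R n m.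
Let L : 'M[R]_(n * m) := block_laplacian G.
Let Q11G := Q11 As alpha beta G.
Let Q12G := Q12 As alpha beta G.
Let l := lambda2 (laplacian G + (laplacian G)^T).
Implicit Types e y : 'cV[R]_(n * m).

(** Orthogonality to the null space of [Q11], which is the same for all the
    graphs of the sequence. *)
Definition perp_null e := forall v : 'cV[R]_m, A *m v = 0 -> dot (S^T *m v) e = 0.

Lemma Q11E : Q11G = (alpha / 2) *: (L + L^T) + beta *: ((S *m bA)^T *m (S *m bA)).
Proof.
rewrite /Q11G /Q11 -(mulmxA _ (ones_kron R n m)) ones_kronE trmx_mul.
by rewrite !mulmxA.
Qed.

Lemma Q11_sym : Q11G^T = Q11G.
Proof.
rewrite Q11E linearD !linearZ /= linearD /= trmxK trmx_mul trmxK.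
by rewrite [L^T + L]addrC.
Qed.

Lemma Q11_quad e :
  dot e (Q11G *m e)
  = alpha * dot e (L *m e) + beta * dot (S *m (bA *m e)) (S *m (bA *m e)).
Proof.
rewrite Q11E mulmxDl -!scalemxAl dotDr !dotZr -dot_block_laplacian.
rewrite -(mulmxA _ (S *m bA)) -dot_mulmx -mulmxA; congr (_ + _).
by field.
Qed.

Lemma Q12_bilinear e y :
  dot e (Q12G *m y)
  = 2^-1 * (n%:R * beta * dot (bA *m e) y + alpha * dot (bA *m (L *m e)) y
            + beta * dot (S *m (bA *m e)) (S *m (bA *m (bA^T *m y)))).
Proof.
rewrite /Q12G /Q12 -(mulmxA _ (ones_kron R n m)) ones_kronE.
rewrite -scalemxAl !mulmxDl -!scalemxAl dotZr !dotDr !dotZr -!mulmxA.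
by rewrite -!dot_mulmx.
Qed.

Lemma Q11_psd e : 0 <= dot e (Q11G *m e).
Proof.
rewrite Q11_quad addr_ge0 // mulr_ge0 ?dot_ge0 ?(ltW alpha0) ?(ltW beta0) //.
exact: block_laplacian_psd.
Qed.

(** Both terms of the form vanish: the first forces consensus, the second then
    puts the common value in the null space of [A]. *)
Lemma Q11_null e : Q11G *m e = 0 -> exists2 v, e = S^T *m v & A *m v = 0.
Proof.
move=> Qe; have := Q11_quad e; rewrite Qe dot0r => /esym/eqP.
have Lp := block_laplacian_psd e balG.
rewrite paddr_eq0 ?mulr_ge0 ?dot_ge0 ?(ltW alpha0) ?(ltW beta0) //.
rewrite !mulf_eq0 (gt_eqF alpha0) (gt_eqF beta0) /= => /andP[/eqP Le /eqP/dot_eq0 Se].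
have [v ev] := block_laplacian_eq0 (ltnW n1) balG conG Le.
by exists v => //; rewrite -Se ev blocksum_blkdiag_rep.
Qed.

(** A Fiedler vector [w] of the graph yields a vector orthogonal to the null
    space of [Q11] on which the aggregate term [S bA e] vanishes: there are [u]
    and [v <> 0] with [A u + sum_i w_i A_i v = 0], trivially when [A] is singular
    and by inverting [A] otherwise. *)
Lemma Q11_test_vector : A != 0 ->
  exists e : 'cV[R]_(n * m), [/\ perp_null e, 0 < dot e (Q11G *m e) &
    dot e (Q11G *m e) <= alpha / 2 * l * dot e e].
Proof.
move=> A0; have [l0 [w w0 Lw] _] := lambda2_laplacian n1 balG conG.
rewrite -/l in l0 Lw.
have sumw : \sum_i w i 0 = 0.
  have one_w : dot (const_mx 1) w = \sum_i w i 0.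
    by apply: eq_bigr => i _; rewrite mxE mul1r.
  have : l * dot (const_mx 1) w = 0.
    rewrite -dotZr -Lw dot_mulmxr linearD /= trmxK addrC.
    by rewrite laplacian_sym_const ?dot0l // => i j; rewrite !mxE.
  by move/eqP; rewrite mulf_eq0 (gt_eqF l0) /= one_w => /eqP.
have [u [v [v0 uv up]]] : exists u v : 'cV[R]_m,
    [/\ v != 0, A *m u + (\sum_i w i 0 *: As i) *m v = 0 &
        forall v', A *m v' = 0 -> dot v' u = 0].
  have [[v v0 Av]|inj] := pselect (exists2 v : 'cV[R]_m, v != 0 & A *m v = 0).
    exists 0, v; split => //; last by move=> v' _; rewrite dot0r.
    rewrite mulmx0 add0r mulmx_suml big1 // => i _.
    by rewrite -scalemxAl nullA ?scaler0.
  have injA (v : 'cV[R]_m) : A *m v = 0 -> v = 0.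
    by move=> Av; apply: contrapT => /eqP v0; apply: inj; exists v.
  have uA := injective_unitmx injA.
  have [j Aj] : exists j, A *m delta_mx j 0 != 0 :> 'cV[R]_m.
    apply: contrapT => h; case/eqP: A0; apply/matrixP => i j.
    rewrite [RHS]mxE; apply: contrapT => Aij; apply: h; exists j.
    by rewrite -colE; apply: contra_notN Aij => /eqP/colP/(_ i); rewrite !mxE.
  pose v : 'cV[R]_m := delta_mx j 0.
  exists (- (invmx A *m ((\sum_i w i 0 *: As i) *m v))), v; split.
  - by apply: contraNneq Aj => v0; rewrite -/v v0 mulmx0.
  - by rewrite mulmxN mulmxA mulmxV // mul1mx addNr.
  - by move=> v' /injA ->; rewrite dot0l.
have Sk : S *m kron w v = 0.
  rewrite blocksumE; under eq_bigr do rewrite block_kron.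
  by rewrite -scaler_suml sumw scale0r.
pose k := kron w v; pose e := S^T *m u + k.
have kk : 2 * dot k (L *m k) = l * dot k k.
  rewrite dot_block_laplacian block_laplacian_sym dot_tens dot_slice mulr_sumr.
  apply: eq_bigr => p _; rewrite slice_kron -scalemxAr Lw.
  by rewrite !dotZl !dotZr; ring.
have kpos : 0 < dot k k.
  rewrite dot_gt0 //; apply: contraNneq v0 => k0; apply/eqP/colP => p.
  have [i wi] : exists i, w i 0 != 0.
    apply: contrapT => h; case/eqP: w0; apply/colP => i; rewrite mxE.
    by apply: contrapT => /eqP wi; apply: h; exists i.
  have := block_kron w v i; rewrite -/k k0 => /colP/(_ p).
  by rewrite !mxE => /esym/eqP; rewrite mulf_eq0 (negPf wi) => /eqP.
have ek : 2 * dot e (L *m e) = l * dot k k.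
  rewrite -kk /e mulmxDr laplacian_rep // add0r dotDl dot_mulmx trmxK.
  by rewrite blocksum_laplacian dot0r add0r.
have Se : S *m (bA *m e) = 0.
  by rewrite /e !mulmxDr blocksum_blkdiag_rep blocksum_blkdiag_kron.
have Qe : dot e (Q11G *m e) = alpha / 2 * l * dot k k.
  rewrite Q11_quad Se dot0l mulr0 addr0.
  have -> : alpha / 2 * l * dot k k = alpha / 2 * (l * dot k k) by rewrite mulrA.
  by rewrite -ek; field.
exists e; split.
- move=> v' Av'; rewrite dot_mulmx trmxK /e mulmxDr Sk addr0 mulmxA blocksum_rep.
  by rewrite mul_scalar_mx dotZr up // mulr0.
- by rewrite Qe !mulr_gt0.
- rewrite Qe ler_pM2l ?mulr_gt0 // /e dotDl !dotDr.
  rewrite [dot (S^T *m u) k]dot_mulmx [dot k (S^T *m u)]dot_mulmxr trmxK Sk.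
  by rewrite dot0l dot0r addr0 add0r lerDr dot_ge0.
Qed.

Lemma lambda2_Q11 : A != 0 ->
  [/\ 0 < lambda2 Q11G, lambda2 Q11G <= alpha / 2 * l &
      forall e, perp_null e -> lambda2 Q11G * dot e e <= dot e (Q11G *m e)].
Proof.
move=> A0; have [e [ep eQ0 eQ]] := Q11_test_vector A0.
have Q0 : Q11G != 0.
  by apply: contraTneq eQ0 => ->; rewrite mul0mx dot0r ltxx.
have [q0 _ qP] := lambda2P Q11_sym Q11_psd Q0.
have qQ e' : perp_null e' -> lambda2 Q11G * dot e' e' <= dot e' (Q11G *m e').
  by move=> ep'; apply: qP => v /Q11_null[v' -> Av']; exact: ep'.
split => //; have ee : 0 < dot e e.
  rewrite dot_gt0 //; apply: contraTneq eQ0 => ->.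
  by rewrite mulmx0 dot0r ltxx.
by rewrite -(ler_pM2r ee) (le_trans (qQ _ ep)).
Qed.

(** The Laplacian drops out, so this value is the same for all graphs; it is
    positive as soon as [A u <> 0]. *)
Lemma Q12_rep (u : 'cV[R]_m) :
  dot (S^T *m u) (Q12G *m (S^T *m (A *m u)))
  = beta / 2 * (n%:R * dot (A *m u) (A *m u)
      + dot (bA^T *m (S^T *m (A *m u))) (bA^T *m (S^T *m (A *m u)))).
Proof.
rewrite Q12_bilinear laplacian_rep // mulmx0 dot0l mulr0 addr0.
rewrite blocksum_blkdiag_rep -/A.
have -> : dot (A *m u) (S *m (bA *m (bA^T *m (S^T *m (A *m u)))))
    = dot (bA^T *m (S^T *m (A *m u))) (bA^T *m (S^T *m (A *m u))).
  by rewrite dot_mulmxr dot_mulmxr.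
have -> : dot (bA *m (S^T *m u)) (S^T *m (A *m u)) = dot (A *m u) (A *m u).
  by rewrite dot_mulmxr trmxK blocksum_blkdiag_rep.
by field.
Qed.

(** The bound [gamma_bar <= g] unfolded through [lambda_maxP]. *)
Lemma gain_bound g y : A != 0 -> gamma_bar As alpha beta G <= g ->
  dot (Q12G *m y) (Q12G *m y)
  <= lambda2 Q11G * (n%:R * beta * dot (bA^T *m y) (bA^T *m y)
                     + g * l / 2 * dot y y).
Proof.
move=> A0 gg; have [q0 _ _] := lambda2_Q11 A0.
have [l0 _ _] := lambda2_laplacian n1 balG conG.
rewrite -/l in l0.
set M := (lambda2 Q11G)^-1 *: (Q12G^T *m Q12G) - (n%:R * beta) *: (bA *m bA^T).
have symM : M^T = M.
  rewrite /M [LHS]linearB /= [X in X - _]linearZ /= [X in _ - X]linearZ /=.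
  by rewrite !trmx_mul !trmxK.
have lM : lambda_max M <= g * l / 2.
  have : 2 / l * lambda_max M <= g.
    by apply: le_trans gg; rewrite /gamma_bar le_max lexx.
  rewrite mulrAC ler_pdivrMr // => h; rewrite ler_pdivlMr // mulrC; exact: h.
have h := lambda_maxP symM y.
rewrite {1}/M mulmxBl -!scalemxAl dotBr !dotZr -!mulmxA in h.
rewrite -[dot y (bA *m _)]dotC dot_mulmx -[dot y (Q12G^T *m _)]dot_mulmx in h.
rewrite -ler_pdivrMl // -lerBlDl.
by apply: le_trans h _; rewrite ler_wpM2r ?dot_ge0.
Qed.

End Forms.

(** * Uniform coercivity of the dissipation *)

Section Coercivity.
Context {R : realType} {n m : nat}.
Variables (As : 'I_n -> 'M[R]_m) (alpha beta : R).
Hypotheses (alpha0 : 0 < alpha) (beta0 : 0 < beta) (n1 : (1 < n)%N).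

Let A := \sum_i As i.
Let bA := blkdiag As.
Let S := @blocksum R n m.

(** Along trajectories this is minus half of the derivative of
    [|e|^2 + |y|^2], where [y] is the disagreement part of the auxiliary state. *)
Definition dissipation (G : wdigraph R n) (gamma : R) (e y : 'cV[R]_(n * m)) : R :=
  dot e (Q11 As alpha beta G *m e) + 2 * dot e (Q12 As alpha beta G *m y)
  + n%:R * beta * dot (bA^T *m y) (bA^T *m y)
  + gamma * dot y (block_laplacian G *m y).

Let fiedler (G : wdigraph R n) := lambda2 (laplacian G + (laplacian G)^T).

Section OneGraph.
Variable G : wdigraph R n.
Hypotheses (balG : weight_balanced G) (conG : strongly_connected G).
Hypothesis nullA : forall (i : 'I_n) (v : 'cV[R]_m),
  (\sum_j As j) *m v = 0 -> As i *m v = 0.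

(** Young's inequality
    [2 e Q12 y >= - (q / (1 + tau)) |e|^2 - ((1 + tau) / q) |Q12 y|^2], with
    [q = lambda2 Q11].  At [tau = 0] the gain condition absorbs the last term but
    nothing is left of [q |e|^2]; a small [tau] keeps a part of it, and is paid
    for by the margin [gamma - g]. *)
Lemma dissipation_ge g gamma tau (e y : 'cV[R]_(n * m)) : A != 0 -> 0 < tau ->
  0 <= gamma -> gamma_bar As alpha beta G <= g -> perp_null As e -> S *m y = 0 ->
  tau / (1 + tau) * lambda2 (Q11 As alpha beta G) * dot e e
  + ((gamma - (1 + tau) * g) * fiedler G / 2 * dot y y
     - tau * (n%:R * beta * dot (bA^T *m y) (bA^T *m y)))
  <= dissipation G gamma e y.
Proof.
move=> A0 tau0 gamma0 gg ep Sy.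
have [q0 _ qP] := lambda2_Q11 alpha0 beta0 n1 balG conG nullA A0.
have qe := qP e ep.
have gain := gain_bound alpha0 beta0 n1 balG conG nullA y A0 gg.
have Ly := block_laplacian_ge n1 balG conG Sy.
rewrite -/(fiedler G) in gain Ly; rewrite -/bA in gain.
rewrite /dissipation.
move: q0 qe gain Ly.
set q := lambda2 (Q11 _ _ _ _); set P := dot e (Q11 _ _ _ _ *m e).
set X := dot e (Q12 _ _ _ _ *m y); set s := dot (Q12 _ _ _ _ *m y) _.
set a := dot (bA^T *m y) _; set Z := dot y (_ *m y); set l := fiedler G.
set E := dot e e; set Y := dot y y => q0 qe gain Ly.
have T0 : 0 < 1 + tau by lra.
pose p := q / (1 + tau).
have p0 : 0 < p by rewrite divr_gt0.
have young : - (p * E) - s / p <= 2 * X.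
  have := dot_ge0 (p *: e + Q12 As alpha beta G *m y).
  rewrite dotDl !dotDr !dotZl !dotZr [dot (_ *m y) e]dotC -/X -/s -/E => h.
  rewrite -(ler_pM2l p0).
  have -> : p * (- (p * E) - s / p) = - (p * (p * E)) - s by field; rewrite gt_eqF.
  lra.
have sp : s / p <= (1 + tau) * (n%:R * beta * a + g * l / 2 * Y).
  rewrite ler_pdivrMr // mulrAC.
  have -> : (1 + tau) * p * (n%:R * beta * a + g * l / 2 * Y)
    = q * (n%:R * beta * a + g * l / 2 * Y).
    by rewrite /p; field; rewrite gt_eqF.
  exact: gain.
have qp : tau / (1 + tau) * q * E = q * E - p * E.
  by rewrite /p; field; rewrite gt_eqF.
have gZ : gamma * (l * Y) <= gamma * (2 * Z) by rewrite ler_wpM2l.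
rewrite qp; lra.
Qed.

End OneGraph.

Variable G : R -> wdigraph R n.
Hypotheses (conG : forall t : R, 0 <= t -> strongly_connected (G t))
  (balG : forall t : R, 0 <= t -> weight_balanced (G t)).

(** When all [A_i] vanish, the two states decouple and each follows the
    consensus dynamics. *)
Lemma coercive_degenerate gamma d :
  (forall i, As i = 0) -> 0 < gamma -> 0 < d ->
  (forall t, 0 <= t -> d <= fiedler (G t)) ->
  exists2 c : R, 0 < c & forall t (e y : 'cV[R]_(n * m)), 0 <= t ->
    perp_null As e -> S *m y = 0 ->
    c * (dot e e + dot y y) <= dissipation (G t) gamma e y.
Proof.
move=> As0 gamma0 d0 dG.
have bA0 : bA = 0.
  by apply/matrixP => k l; rewrite !mxE As0; case: ifP => _ //; rewrite mxE.
exists (Num.min alpha gamma * (d / 2)) => [|t e y t0 ep Sy].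
  by rewrite mulr_gt0 ?divr_gt0 // lt_min alpha0.
have Se : S *m e = 0.
  apply: dot_eq0; rewrite dot_mulmx dotC; apply: ep.
  by rewrite big1 ?mul0mx // => i _; exact: As0.
have [balt cont dt] := And3 (balG t0) (conG t0) (dG t t0).
rewrite /dissipation Q11_quad Q12_bilinear -/bA bA0 !trmx0 !mul0mx !mulmx0.
rewrite !(dot0l, mulr0, addr0).
have bound k z : 0 < k -> Num.min alpha gamma <= k -> S *m z = 0 ->
    Num.min alpha gamma * (d / 2) * dot z z <= k * dot z (block_laplacian (G t) *m z).
  move=> k0 mk Sz; have zz := dot_ge0 z.
  have h := block_laplacian_ge n1 balt cont Sz; rewrite -/(fiedler _) in h.
  have h1 : d * dot z z <= fiedler (G t) * dot z z by rewrite ler_wpM2r.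
  have h2 : d / 2 * dot z z <= dot z (block_laplacian (G t) *m z) by lra.
  apply: (@le_trans _ _ (k * (d / 2 * dot z z))); last by rewrite ler_pM2l.
  by rewrite -mulrA ler_wpM2r // mulr_ge0 // divr_ge0 // ltW.
by rewrite mulrDr lerD // bound // ge_min lexx ?orbT.
Qed.

(** A lower bound for [lambda2 Q11] comes from Cauchy-Schwarz applied to
    [kappa = x0 Q12 y0], a positive number independent of the graph:
    [kappa^2 <= |x0|^2 |Q12 y0|^2 <= lambda2 Q11 * D].  It passes to the
    algebraic connectivity by [lambda2_Q11], and then one [tau] serves all
    times. *)
Lemma coercive_uniform g gamma a : A != 0 ->
  (forall (i : 'I_n) (v : 'cV[R]_m), A *m v = 0 -> As i *m v = 0) ->
  0 <= g -> g < gamma ->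
  (forall t, 0 <= t -> gamma_bar As alpha beta (G t) <= g) ->
  0 < a -> (forall t i j, 0 <= t -> adj (G t) i j < a) ->
  exists2 c : R, 0 < c & forall t (e y : 'cV[R]_(n * m)), 0 <= t ->
    perp_null As e -> S *m y = 0 ->
    c * (dot e e + dot y y) <= dissipation (G t) gamma e y.
Proof.
move=> A0 nullA g0 ggamma gG a0 aG.
have n0 : 0 < n%:R :> R by rewrite ltr0n (ltnW n1).
have nb : 0 < n%:R * beta by rewrite mulr_gt0.
have [K K0 bK] := mulmx_bounded bA^T.
pose B := 4 * n%:R * a.
have B0 : 0 < B by rewrite !mulr_gt0.
have lB t : 0 <= t -> fiedler (G t) <= B.
  move=> t0; have [_ [w w0 Lw] _] := lambda2_laplacian n1 (balG t0) (conG t0).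
  by apply: (lambda2_laplacian_le (balG t0) _ w0 Lw) => i j; exact: aG.
have [u Au] : exists u : 'cV[R]_m, A *m u != 0.
  apply: contrapT => h; case/eqP: A0; apply/matrixP => i j.
  rewrite [RHS]mxE; apply: contrapT => Aij; apply: h; exists (delta_mx j 0).
  by rewrite -colE; apply: contra_notN Aij => /eqP/colP/(_ i); rewrite !mxE.
pose y0 := S^T *m (A *m u); pose x0 := S^T *m u.
pose kappa := beta / 2 * (n%:R * dot (A *m u) (A *m u) + dot (bA^T *m y0) (bA^T *m y0)).
have kappa0 : 0 < kappa.
  rewrite mulr_gt0 ?divr_gt0 // ltr_wpDr ?dot_ge0 // mulr_gt0 ?dot_gt0 //.
(* The summand 1 only serves to make [D] positive. *)
pose D := dot x0 x0 * ((n%:R * beta * K + g * B / 2) * dot y0 y0) + 1.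
have gB0 : 0 <= g * B / 2 by rewrite divr_ge0 // mulr_ge0 // ltW.
have D0 : 0 < D.
  rewrite ltr_wpDl // mulr_ge0 ?dot_ge0 // mulr_ge0 ?dot_ge0 // addr_ge0 //.
  by rewrite mulr_ge0 // ltW.
pose q0 := kappa ^+ 2 / D.
have q00 : 0 < q0 by rewrite divr_gt0 // exprn_gt0.
have qlow t : 0 <= t -> q0 <= lambda2 (Q11 As alpha beta (G t)).
  move=> t0; have [qt0 _ _] :=
    lambda2_Q11 alpha0 beta0 n1 (balG t0) (conG t0) nullA A0.
  have [l0 _ _] := lambda2_laplacian n1 (balG t0) (conG t0).
  have gain := gain_bound alpha0 beta0 n1 (balG t0) (conG t0) nullA y0 A0 (gG t t0).
  rewrite -/(fiedler _) -/bA in gain l0.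
  have CS := dot_CauchySchwarz x0 (Q12 As alpha beta (G t) *m y0).
  rewrite (Q12_rep _ _ _ (balG t0)) -/bA -/A -/y0 -/kappa in CS.
  rewrite ler_pdivrMr //; apply: le_trans CS _.
  set q := lambda2 (Q11 _ _ _ _) in qt0 gain *.
  have h : dot (Q12 As alpha beta (G t) *m y0) (Q12 As alpha beta (G t) *m y0)
      <= q * ((n%:R * beta * K + g * B / 2) * dot y0 y0).
    apply: le_trans gain _; rewrite ler_pM2l // mulrDl lerD //.
      by rewrite -[leRHS]mulrA ler_pM2l.
    rewrite ler_wpM2r ?dot_ge0 // ler_pM2r // ler_wpM2l //; exact: lB.
  apply: le_trans (ler_wpM2l (dot_ge0 x0) h) _.
  by rewrite mulrCA ler_pM2l // /D lerDl.
pose d := 2 * q0 / alpha.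
have d0 : 0 < d by rewrite divr_gt0 // mulr_gt0.
have dlow t : 0 <= t -> d <= fiedler (G t).
  move=> t0; have [_ ql _] := lambda2_Q11 alpha0 beta0 n1 (balG t0) (conG t0) nullA A0.
  rewrite ler_pdivrMr //; have := le_trans (qlow t t0) ql.
  rewrite -/(fiedler _); lra.
pose M := n%:R * beta * K + g * B / 2 + 1.
(* Half of the margin [(gamma - g) d / 2] pays for Young's inequality. *)
pose tau := (gamma - g) * d / (4 * M).
have M0 : 0 < M.
  by rewrite ltr_wpDl // addr_ge0 // mulr_ge0 // ltW.
have gg0 : 0 < gamma - g by rewrite subr_gt0.
have tau0 : 0 < tau by apply: divr_gt0; apply: mulr_gt0.
have tauM : tau * (n%:R * beta * K + g * B / 2) <= (gamma - g) * d / 4.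
  have -> : (gamma - g) * d / 4 = tau * M.
    by rewrite /tau; field; rewrite gt_eqF.
  by rewrite ler_pM2l // lerDl.
have T0 : 0 < tau / (1 + tau) by rewrite divr_gt0 // addr_gt0.
pose c1 := tau / (1 + tau) * q0; pose c2 := (gamma - g) * d / 4.
have c10 : 0 < c1 by rewrite mulr_gt0.
have c20 : 0 < c2 by rewrite divr_gt0 // mulr_gt0.
exists (Num.min c1 c2) => [|t e y t0 ep Sy]; first by rewrite lt_min c10.
have gamma0 : 0 <= gamma by rewrite (le_trans g0) // ltW.
have := @dissipation_ge (G t) (balG t0) (conG t0) nullA g gamma tau e y A0 tau0
  gamma0 (gG t t0) ep Sy.
apply: le_trans; rewrite mulrDr lerD //.
  rewrite ler_wpM2r ?dot_ge0 // (@le_trans _ _ c1) ?ge_min ?lexx // ler_pM2l //.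
  exact: qlow.
apply: (@le_trans _ _ (c2 * dot y y)).
  by rewrite ler_wpM2r ?dot_ge0 // ge_min lexx orbT.
have hK : tau * (n%:R * beta * dot (bA^T *m y) (bA^T *m y))
    <= tau * (n%:R * beta * K) * dot y y.
  have -> : tau * (n%:R * beta * K) * dot y y = tau * (n%:R * beta * (K * dot y y)).
    by ring.
  by rewrite !ler_pM2l.
have hl : tau * g * fiedler (G t) / 2 <= tau * (g * B / 2).
  have -> : tau * g * fiedler (G t) / 2 = tau * (g * fiedler (G t) / 2) by ring.
  by rewrite ler_pM2l // ler_pM2r // ler_wpM2l // lB.
have hd : (gamma - g) * d / 2 <= (gamma - g) * fiedler (G t) / 2.
  by rewrite ler_pM2r // ler_pM2l // dlow.
have Y0 := dot_ge0 y.
have : c2 + tau * (n%:R * beta * K)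
    <= (gamma - (1 + tau) * g) * fiedler (G t) / 2.
  rewrite /c2; move: tauM hl hd; lra.
move=> /(ler_wpM2r Y0); rewrite mulrDl; lra.
Qed.

End Coercivity.

(** * Lyapunov analysis of the trajectories *)

(** The orthogonal projection onto the vectors with zero block sum. *)
Definition disagreement (R : realType) (n m : nat) : 'M[R]_(n * m) :=
  1%:M - n%:R^-1 *: (blocksum^T *m blocksum).

Section Dynamics.
Context {R : realType} {n m : nat}.
Variables (As : 'I_n -> 'M[R]_m) (alpha beta gamma : R).
Hypothesis n1 : (1 < n)%N.

Let A := \sum_i As i.
Let bA := blkdiag As.
Let S := @blocksum R n m.
Let D := disagreement R n m.
Implicit Types (G : wdigraph R n) (x y z : 'cV[R]_(n * m)).

Definition x_field (G : wdigraph R n) (x y : 'cV[R]_(n * m)) : 'cV[R]_(n * m) :=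
  - (alpha *: (block_laplacian G *m x)) - (n%:R * beta) *: (bA^T *m y).

Definition y_field (G : wdigraph R n) (x y : 'cV[R]_(n * m)) : 'cV[R]_(n * m) :=
  - (alpha *: (bA *m block_laplacian G *m x))
  - (n%:R * beta) *: (bA *m bA^T *m y) - gamma *: (block_laplacian G *m y).

Let n0 : n%:R != 0 :> R.
Proof. by rewrite pnatr_eq0 -lt0n ltnW. Qed.

Lemma disagreementE y : D *m y = y - n%:R^-1 *: (S^T *m (S *m y)).
Proof. by rewrite mulmxBl mul1mx -scalemxAl mulmxA. Qed.

Lemma blocksum_disagreement y : S *m (D *m y) = 0.
Proof.
rewrite disagreementE mulmxBr -scalemxAr (mulmxA S) blocksum_rep mul_scalar_mx.
by rewrite scalerA mulVf // scale1r subrr.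
Qed.

Lemma dot_disagreement y z : S *m y = 0 -> dot y (D *m z) = dot y z.
Proof.
move=> Sy; rewrite disagreementE dotBr dotZr dot_mulmxr trmxK Sy.
by rewrite dot0l mulr0 subr0.
Qed.

Lemma norm_disagreement y :
  dot y y = dot (D *m y) (D *m y)
            + n%:R^-1 * dot (S *m y) (S *m y).
Proof.
rewrite dot_disagreement ?blocksum_disagreement // disagreementE dotBl dotZl.
by rewrite dot_mulmx trmxK subrK.
Qed.

(** The sum of the auxiliary states moves with the aggregate of the local
    evaluations [A_i x_i], because Laplacians have zero column sums. *)
Lemma blocksum_y_field G x y :
  S *m y_field G x y - (S *m bA) *m x_field G x y = 0.
Proof.
rewrite /y_field /x_field !mulmxDr !mulmxN -!scalemxAr blocksum_laplacian.
rewrite scaler0 oppr0 addr0 !mulmxA; exact: subrr.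
Qed.

(** Replicated null vectors are invisible to both terms: [bL^T] kills replicated
    vectors and [bA] kills replicated common null vectors. *)
Lemma perp_x_field G x y (v : 'cV[R]_m) : (forall i, As i *m v = 0) ->
  dot (S^T *m v) (x_field G x y) = 0.
Proof.
move=> Av; rewrite /x_field dotBr dotNr !dotZr.
rewrite dot_mulmx trmxK blocksum_laplacian dot0r mulr0 oppr0 add0r.
rewrite [dot (S^T *m v) (bA^T *m y)]dot_mulmxr trmxK.
have -> : bA *m (S^T *m v) = 0.
  apply: block_inj => i; rewrite block_blkdiag block_rep Av.
  by apply/colP => p; rewrite !mxE.
by rewrite dot0l mulr0 oppr0.
Qed.

(** Substitute [y = yp + S^T (S bA e) / n]: the mean part of [y] turns the term
    [n beta bA^T y] into the aggregate terms of [Q11] and [Q12]. *)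
Lemma dissipation_identity G x y (xs : 'cV[R]_m) : weight_balanced G ->
  let e := x - S^T *m xs in S *m y = S *m (bA *m e) ->
  dot e (x_field G x y) + dot (D *m y) (D *m y_field G x y)
  = - dissipation As alpha beta G gamma e (D *m y).
Proof.
move=> balG e Sy; set yp := D *m y.
have Sp : S *m yp = 0 by exact: blocksum_disagreement.
have yE : y = yp + n%:R^-1 *: (S^T *m (S *m (bA *m e))).
  by rewrite -Sy /yp disagreementE subrK.
have Lx : block_laplacian G *m x = block_laplacian G *m e.
  by rewrite /e mulmxBr laplacian_rep // subr0.
have Ly : block_laplacian G *m y = block_laplacian G *m yp.
  by rewrite {1}yE mulmxDr -scalemxAr laplacian_rep // scaler0 addr0.
rewrite dot_disagreement // /x_field /y_field -!(mulmxA bA) Lx Ly.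
rewrite yE -/yp; set r := S *m (bA *m e).
rewrite !(mulmxDr _ yp) -!scalemxAr (mulmxDr _ (bA^T *m yp)) -!scalemxAr !(dotBr, dotDr, dotNr, dotZr).
rewrite /dissipation Q11_quad Q12_bilinear -/bA -/S -/r.
have -> : dot e (bA^T *m yp) = dot (bA *m e) yp by rewrite -dot_mulmx.
have -> : dot e (bA^T *m (S^T *m r)) = dot r r by rewrite -dot_mulmx -dot_mulmx.
have -> : dot yp (bA *m (block_laplacian G *m e))
  = dot (bA *m (block_laplacian G *m e)) yp by rewrite dotC.
have -> : dot yp (bA *m (bA^T *m yp)) = dot (bA^T *m yp) (bA^T *m yp).
  by rewrite dot_mulmxr.
have -> : dot yp (bA *m (bA^T *m (S^T *m r))) = dot r (S *m (bA *m (bA^T *m yp))).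
  by rewrite [RHS]dotC [RHS]dot_mulmx [RHS]dot_mulmx [RHS]dot_mulmx trmxK.
by field.
Qed.

End Dynamics.

Lemma norm2_col_mx (R : realType) k l (u : 'cV[R]_k) (v : 'cV[R]_l) :
  norm2 (col_mx u v) = Num.sqrt (dot u u + dot v v).
Proof.
rewrite /norm2 big_split_ord /=; congr Num.sqrt; congr (_ + _).
  by apply: eq_bigr => i _; rewrite col_mxEu expr2.
by apply: eq_bigr => i _; rewrite col_mxEd expr2.
Qed.

Section Convergence.
Context {R : realType} {n m : nat}.
Variables (As : 'I_n -> 'M[R]_m) (bs : 'I_n -> 'cV[R]_m) (alpha beta gamma : R).
Variables (G : R -> wdigraph R n) (x y : R -> 'cV[R]_(n * m)) (xs : 'cV[R]_m).
Variable c : R.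
Let A := \sum_i As i.
Let bA := blkdiag As.
Let S := @blocksum R n m.
Hypotheses (n1 : (1 < n)%N) (balG : forall t, 0 <= t -> weight_balanced (G t)).
Hypothesis nullA : forall (i : 'I_n) (v : 'cV[R]_m), A *m v = 0 -> As i *m v = 0.
Hypothesis c0 : 0 < c.
Hypothesis coercive : forall t (e z : 'cV[R]_(n * m)), 0 <= t ->
  perp_null As e -> S *m z = 0 ->
  c * (dot e e + dot z z) <= dissipation As alpha beta (G t) gamma e z.
Hypothesis traj : is_trajectory As alpha beta gamma G x y.
Hypothesis Axs : A *m xs = \sum_i bs i.
Hypothesis init : S *m y 0 = S *m (bA *m x 0 - stack bs).
Hypothesis perp0 : perp_null As (x 0 - S^T *m xs).

Let acx T : 0 <= T -> coord_abs_cont x T.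
Proof. by move=> T0; apply: locally_abs_continuous_coord => //; case: traj. Qed.

Let acy T : 0 <= T -> coord_abs_cont y T.
Proof. by move=> T0; apply: locally_abs_continuous_coord => //; case: traj. Qed.

Let deriv : {ae lebesgue_measure, forall t : R, 0 <= t ->
  coord_derive x t (x_field As alpha beta (G t) (x t) (y t)) /\
  coord_derive y t (y_field As alpha beta gamma (G t) (x t) (y t))}.
Proof.
case: traj => _ _; apply: ae_weaken => t h t0; have [hx hy] := h t0.
by split; exact: is_derive_coord.
Qed.

Let e t := x t - S^T *m xs.

Lemma blocksum_conserved t : 0 <= t -> S *m y t = S *m (bA *m e t).
Proof.
move=> t0.
have cons : S *m y t - (S *m bA) *m x t = S *m y 0 - (S *m bA) *m x 0.
  apply: (coord_abs_cont_constant (x := fun s => S *m y s - (S *m bA) *m x s)) => //.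
    move=> T T0; apply: coord_abs_contB; apply: coord_abs_cont_mulmx => //.
      exact: acy.
    exact: acx.
  apply: ae_weaken deriv => s h s0; have [hx hy] := h s0.
  rewrite -(blocksum_y_field As alpha beta gamma (G s) (x s) (y s)).
  by apply: coord_deriveB; exact: coord_derive_mulmx.
have Ss : S *m (bA *m (S^T *m xs)) = S *m stack bs.
  by rewrite blocksum_blkdiag_rep blocksum_stack Axs.
rewrite /e !mulmxBr Ss.
rewrite -!mulmxA init mulmxBr in cons.
rewrite -[LHS](subrK (S *m (bA *m x t))) cons addrC; congr (_ + _).
by rewrite addrAC subrr add0r.
Qed.

Lemma perp_conserved t : 0 <= t -> perp_null As (e t).
Proof.
move=> t0 v Av; rewrite -(perp0 Av).
apply: (abs_cont_constant (f := fun s => dot (S^T *m v) (e s))) => //.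
  apply: abs_cont_dot => //; first exact: coord_abs_cont_cst.
  by apply: coord_abs_contB; [exact: acx | exact: coord_abs_cont_cst].
apply: ae_weaken deriv => s h s0; have [hx _] := h s0.
have -> : 0 = dot (S^T *m v) (x_field As alpha beta (G s) (x s) (y s) - 0)
    + dot 0 (e s).
  by rewrite dot0l addr0 subr0 perp_x_field // => i; exact: nullA.
apply: is_derive_dot; first exact: coord_derive_cst.
by apply: coord_deriveB => //; exact: coord_derive_cst.
Qed.

Let V t := dot (e t) (e t) + dot (disagreement R n m *m y t) (disagreement R n m *m y t).

Lemma lyapunov_decay t : 0 <= t -> V t <= V 0 * expR (- (2 * c) * t).
Proof.
move: t; pose dx s := x_field As alpha beta (G s) (x s) (y s).
pose dy s := y_field As alpha beta gamma (G s) (x s) (y s).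
pose P := disagreement R n m.
apply: (@exponential_decay _ V
  (fun s => 2 * (dot (e s) (dx s) + dot (P *m y s) (P *m dy s)))).
- by rewrite mulr_gt0.
- move=> T T0; apply: abs_contD.
    have ace : coord_abs_cont e T.
      by apply: coord_abs_contB; [exact: acx | exact: coord_abs_cont_cst].
    exact: abs_cont_dot.
  have acP : coord_abs_cont (fun s => P *m y s) T.
    by apply: coord_abs_cont_mulmx => //; exact: acy.
  exact: abs_cont_dot.
- apply: ae_weaken deriv => s h s0; have [hx hy] := h s0; split.
    have de : coord_derive e s (dx s).
      rewrite -[dx s]subr0; apply: coord_deriveB => //; exact: coord_derive_cst.
    have dP : coord_derive (fun r => P *m y r) s (P *m dy s).
      exact: coord_derive_mulmx.
    have -> : 2 * (dot (e s) (dx s) + dot (P *m y s) (P *m dy s))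
      = (dot (e s) (dx s) + dot (dx s) (e s))
        + (dot (P *m y s) (P *m dy s) + dot (P *m dy s) (P *m y s)).
      by rewrite (dotC (dx s)) (dotC (P *m dy s)); ring.
    exact: is_deriveD (is_derive_dot de de) (is_derive_dot dP dP).
  have id := dissipation_identity alpha beta gamma n1 (balG s0)
    (blocksum_conserved s0).
  rewrite -/(e s) in id; rewrite id.
  have := coercive s0 (perp_conserved s0) (blocksum_disagreement n1 (y s)).
  rewrite -/(V s); lra.
Qed.

(** The mean part of [y] is determined by [e], so the Lyapunov function bounds
    the whole state. *)
Lemma trajectory_converges :
  converges_exponentially (fun t => col_mx (x t) (y t))
                          (col_mx (replicate n xs) 0).
Proof.
have [K K0 bK] := mulmx_bounded (S *m bA).
have n0 : 0 < n%:R :> R by rewrite ltr0n ltnW.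
have K1 : 0 < 1 + n%:R^-1 * K by rewrite addr_gt0 // mulr_gt0 // invr_gt0.
exists (Num.sqrt ((1 + n%:R^-1 * K) * V 0) + 1), c; split => //.
move=> t t0; rewrite replicateE opp_col_mx add_col_mx subr0 norm2_col_mx -/(e t).
have V0 : 0 <= V 0 by rewrite addr_ge0 // dot_ge0.
have bound : dot (e t) (e t) + dot (y t) (y t) <= (1 + n%:R^-1 * K) * V t.
  rewrite (norm_disagreement n1 (y t)) blocksum_conserved // addrA -/(V t) mulrDl mul1r.
  rewrite lerD2l -mulrA ler_pM2l ?invr_gt0 // mulmxA.
  apply: le_trans (bK _) _; rewrite ler_pM2l // lerDl; exact: dot_ge0.
have -> : expR (- c * t) = Num.sqrt (expR (- (2 * c) * t)).
  have -> : - (2 * c) * t = - c * t + - c * t by ring.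
  by rewrite expRD -expr2 sqrtr_sqr ger0_norm // expR_ge0.
rewrite mulrDl mul1r; apply: ler_wpDr; first exact: sqrtr_ge0.
rewrite -sqrtrM ?mulr_ge0 ?(ltW K1) // ler_wsqrtr //.
apply: le_trans bound _; rewrite -mulrA ler_pM2l //; exact: lyapunov_decay.
Qed.

End Convergence.

Theorem mainTheorem4 (R : realType) (n m : nat) (G : R -> wdigraph R n)
  (As : 'I_n -> 'M[R]_m) (bs : 'I_n -> 'cV[R]_m) (alpha beta : R)
  (hn : (2 <= n)%N)
  (hconn : forall t : R, 0 <= t -> strongly_connected (G t))
  (hbal : forall t : R, 0 <= t -> weight_balanced (G t))
  (hbound : exists2 a : R, 0 < a &
     forall (t : R) (i j : 'I_n), 0 <= t -> adj (G t) i j < a)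
  (hsol : exists x : 'cV[R]_m, (\sum_i As i) *m x = \sum_i bs i)
  (hnull : forall (i : 'I_n) (v : 'cV[R]_m),
     (\sum_j As j) *m v = 0 -> As i *m v = 0)
  (* only constrains the degenerate equation 0 x = 0, where the claim fails
     for graphs whose connectivity decays in time *)
  (hdeg : \sum_i As i = 0 -> exists2 d : R, 0 < d &
     forall t : R, 0 <= t -> d <= lambda2 (laplacian (G t) + (laplacian (G t))^T))
  (halpha : 0 < alpha) (hbeta : 0 < beta) :
  forall gamma : R, (gamma_hat As alpha beta G < gamma%:E)%E ->
  forall x y : R -> 'cV[R]_(n * m),
    is_trajectory As alpha beta gamma G x y ->
    (ones_kron R n m)^T *m y 0
      = (ones_kron R n m)^T *m (blkdiag As *m x 0 - stack bs) ->
    exists2 xs : 'cV[R]_m, (\sum_i As i) *m xs = \sum_i bs i &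
      converges_exponentially (fun t => col_mx (x t) (y t))
                              (col_mx (replicate n xs) 0).
Proof.
move=> gamma gammaP x y traj /ones_kron_tr init.
have [a a0 aG] := hbound.
have supP t : 0 <= t -> ((gamma_bar As alpha beta (G t))%:E <= gamma_hat As alpha beta G)%E.
  by move=> t0; apply: ereal_sup_ubound; exists t.
have [g [g0 ggamma gG]] : exists g : R, [/\ 0 <= g, g < gamma &
    forall t, 0 <= t -> gamma_bar As alpha beta (G t) <= g].
  move: gammaP supP; case: (gamma_hat As alpha beta G) => [g gg supP|//|_ supP].
    exists g; split => //.
    have := supP 0 (lexx _); rewrite lee_fin; apply: le_trans.
    by rewrite /gamma_bar le_max lexx orbT.
  by have := supP 0 (lexx _).
have [c c0 coercive] : exists2 c : R, 0 < c &
    forall t (e z : 'cV[R]_(n * m)), 0 <= t ->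
      perp_null As e -> blocksum *m z = 0 ->
      c * (dot e e + dot z z) <= dissipation As alpha beta (G t) gamma e z.
  have [A0|A0] := eqVneq (\sum_i As i) 0; last first.
    exact: (coercive_uniform halpha hbeta hn hconn hbal A0 hnull g0 ggamma gG a0 aG).
  have [d d0 dG] := hdeg A0.
  apply: (coercive_degenerate _ halpha hn hconn hbal _ _ d0 dG).
    move=> i; apply/matrixP => p q; rewrite [RHS]mxE.
    have /colP/(_ p) : As i *m delta_mx q 0 = 0 :> 'cV[R]_m.
      by apply: hnull; rewrite A0 mul0mx.
    by rewrite -colE !mxE.
  by rewrite (le_lt_trans g0).
have [x0 Ax0] := hsol.
have [v Av vperp] :=
  null_space_proj (\sum_i As i) (n%:R^-1 *: (blocksum *m x 0) - x0).
(* Among the solutions, [x0 + v] is the one for which the initial error is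
   orthogonal to the null space of [Q11]. *)
exists (x0 + v); first by rewrite mulmxDr Ax0 Av addr0.
apply: (@trajectory_converges _ _ _ As bs alpha beta gamma G) c0 coercive _ _ _ _ => //.
  by rewrite mulmxDr Ax0 Av addr0.
move=> u Au; rewrite dot_mulmx trmxK mulmxBr mulmxA blocksum_rep mul_scalar_mx.
have -> : blocksum *m x 0 - n%:R *: (x0 + v)
    = n%:R *: (n%:R^-1 *: (blocksum *m x 0) - x0 - v).
  rewrite -addrA -opprD scalerBr scalerA divff ?scale1r //.
  by rewrite pnatr_eq0 -lt0n ltnW.
by rewrite dotZr vperp // mulr0.
Qed.
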